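(* If $\pi$ is a plane in $\mathrm{PG}(5,q)$ which is disjoint from the Veronese surface $\mathcal{V}(\mathbb{F}_q)$, and meets the nucleus plane of $\mathcal{V}(\mathbb{F}_q)$ in a point $P$, with $H(P)\neq H(\pi)$, then $\pi$ belongs to one of three $K$-orbits $\Sigma_{21}$, $\Sigma_{22}$, and $\Sigma_{23}$, with $OD_0(\Sigma_{21})=[0,1,2q,q^2-q]$, $OD_0(\Sigma_{22})=[0,1,q,q^2]$ and $OD_0(\Sigma_{23})=[0,1,2q,q^2-q]$. Representatives are $\Sigma_{21}:[x,x+az,\cdot;\ x+az,z,y;\ \cdot,y,\cdot]$, $\Sigma_{22}:[x,x+z,z;\ x+z,z,y;\ z,y,\cdot]$, and $\Sigma_{23}:[x,az,x;\ az,z,y;\ x,y,\cdot]$, with $\operatorname{Tr}(a)=1$.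
   Context: Let $q$ be even ($q\ge4$ for the uniqueness of $H(\pi)$). The Veronese surface $\mathcal{V}(\mathbb{F}_q)\subset\mathrm{PG}(5,q)$ is the image of $(u_0,u_1,u_2)\mapsto(u_0^2,u_0u_1,u_0u_2,u_1^2,u_1u_2,u_2^2)$; a point $(y_0,\dots,y_5)$ is identified with the symmetric matrix $[y_0,y_1,y_2;\ y_1,y_3,y_4;\ y_2,y_4,y_5]$ and has the rank of this matrix; planes are written as symmetric matrices with entries linear forms in $x,y,z$ (''$\cdot$'' = zero). $K\cong\mathrm{PGL}(3,q)$ acts by $M\mapsto AMA^T$. $\operatorname{Tr}$ is the trace $\mathbb{F}_q\to\mathbb{F}_2$. The nucleus plane $\pi_{\mathcal{N}}=\mathcal{Z}(Y_0,Y_3,Y_5)$; for $P\in\pi_{\mathcal{N}}$, $\mathcal{C}(P)$ is the conic of $\mathcal{V}(\mathbb{F}_q)$ with nucleus $P$. $\mathcal{H}_1$ is the $K$-orbit of hyperplanes corresponding to double lines of $\mathrm{PG}(2,q)$ (each meets $\mathcal{V}(\mathbb{F}_q)$ in a conic); $H(P)$ is the unique hyperplane of $\mathcal{H}_1$ containing $\mathcal{C}(P)$. For a plane $\pi$ disjoint from $\mathcal{V}(\mathbb{F}_q)$ meeting $\pi_{\mathcal{N}}$ in a single point, there is a unique hyperplane of $\mathcal{H}_1$ containing $\pi$, denoted $H(\pi)$. $OD_0(\pi)=[r_1,r_{2,n},r_{2,s},r_3]$ counts rank-1 points, points of $\pi\cap\pi_{\mathcal{N}}$, rank-2 points outside $\pi_{\mathcal{N}}$,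 and rank-3 points of $\pi$. *)

(* Defs.v *)
From HB Require Import structures.
From mathcomp Require Import all_boot all_order all_algebra all_field.
From mathcomp Require Import ring.

Set Implicit Arguments.
Unset Strict Implicit.
Unset Printing Implicit Defensive.

Import GRing.Theory.
Local Open Scope ring_scope.

(* Subspaces of PG(n-1, q) are represented by the corresponding subspaces of
   F^n: points, lines, planes and hyperplanes of PG(5, q) have vector dimension
   1, 2, 3 and 5.  Over a finite field there are finitely many of them. *)
Section FiniteSubspaces.

Variables (F : finFieldType) (vT : vectType F).

HB.instance Definition _ :=
  Countable.copy {vspace vT} (can_type (@VectorInternalTheory.vs2mxK F vT)).
HB.instance Definition _ : isFinite {vspace vT} :=
  CanIsFinite (@VectorInternalTheory.vs2mxK F vT).

End FiniteSubspaces.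

Section VeroneseSurface.

Variable F : finFieldType.

Definition points (n : nat) (U : {vspace 'rV[F]_n}) : {set {vspace 'rV[F]_n}} :=
  [set P : {vspace 'rV[F]_n} | (\dim P == 1)%N && (P <= U)%VS].

Definition row6 (y0 y1 y2 y3 y4 y5 : F) : 'rV[F]_6 :=
  \row_(i < 6) [:: y0; y1; y2; y3; y4; y5]`_i.

Definition mx3 (s : seq (seq F)) : 'M[F]_3 :=
  \matrix_(i < 3, j < 3) (nth [::] s i)`_j.

Definition sym_mx (v : 'rV[F]_6) : 'M[F]_3 :=
  mx3 [:: [:: v 0 0; v 0 1; v 0 2];
          [:: v 0 1; v 0 3; v 0 4];
          [:: v 0 2; v 0 4; v 0 5]].

(* Inverse of sym_mx on symmetric matrices. *)
Definition sym_coords (M : 'M[F]_3) : 'rV[F]_6 :=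
  row6 (M 0 0) (M 0 1) (M 0 2) (M 1 1) (M 1 2) (M 2 2).

Lemma sym_mxK : cancel sym_mx sym_coords.
Proof.
move=> v; apply/rowP=> i; rewrite !mxE /=.
by case: i => [[|[|[|[|[|[|//]]]]]] Hi] /=; congr (v _ _); apply: val_inj.
Qed.

(* vpick P is a nonzero vector of P; the rank does not depend on its choice. *)
Definition point_rank (P : {vspace 'rV[F]_6}) : nat := \rank (sym_mx (vpick P)).

Definition veronese (u : 'rV[F]_3) : 'rV[F]_6 :=
  row6 (u 0 0 ^+ 2) (u 0 0 * u 0 1) (u 0 0 * u 0 2)
       (u 0 1 ^+ 2) (u 0 1 * u 0 2) (u 0 2 ^+ 2).

Definition veronese_point (P : {vspace 'rV[F]_3}) : {vspace 'rV[F]_6} :=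
  <[veronese (vpick P)]>%VS.

Definition veronese_surface : {set {vspace 'rV[F]_6}} :=
  [set veronese_point P | P in points fullv].

(* The action of K = PGL(3, q), M |-> A M A^T, on coordinate vectors. *)
Definition Kmap (A : 'M[F]_3) (v : 'rV[F]_6) : 'rV[F]_6 :=
  sym_coords (A *m sym_mx v *m A^T).

Fact Kmap_is_linear (A : 'M[F]_3) : linear (Kmap A).
Proof.
move=> c u v; rewrite /Kmap.
have -> : sym_mx (c *: u + v) = c *: sym_mx u + sym_mx v.
  apply/matrixP=> i j; rewrite !mxE.
  by case: i => [[|[|[|//]]] Hi]; case: j => [[|[|[|//]]] Hj]; rewrite /= ?mxE.
rewrite mulmxDr mulmxDl -scalemxAr -scalemxAl.
set M := _ *m _; set N := _ *m _; apply/rowP=> i; rewrite !mxE.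
by case: i => [[|[|[|[|[|[|//]]]]]] Hi]; rewrite /= ?mxE.
Qed.

HB.instance Definition _ (A : 'M[F]_3) :=
  GRing.isLinear.Build F 'rV[F]_6 'rV[F]_6 _ (Kmap A) (Kmap_is_linear A).

Definition Kact (A : 'M[F]_3) (U : {vspace 'rV[F]_6}) : {vspace 'rV[F]_6} :=
  (linfun (Kmap A) @: U)%VS.

Definition Korbit (U : {vspace 'rV[F]_6}) : {set {vspace 'rV[F]_6}} :=
  [set Kact A U | A : 'M[F]_3 in unitmx].

Definition is_plane_orbit (S : {set {vspace 'rV[F]_6}}) : Prop :=
  exists2 pi : {vspace 'rV[F]_6}, \dim pi = 3%N & S = Korbit pi.

(* The hyperplane Z(a_0 Y_0 + ... + a_5 Y_5), which corresponds to the conic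
   Z(quad_form a) of PG(2, q). *)
Definition hyperplane (a : 'rV[F]_6) : {vspace 'rV[F]_6} :=
  lker (linfun (mulmxr a^T : 'rV[F]_6 -> 'M[F]_1)).

Definition quad_form (a : 'rV[F]_6) (u : 'rV[F]_3) : F :=
  \sum_(i < 6) a 0 i * veronese u 0 i.

(* Coefficients of (l_0 X_0 + l_1 X_1 + l_2 X_2)^2. *)
Definition double_line (l : 'rV[F]_3) : 'rV[F]_6 :=
  row6 (l 0 0 ^+ 2) (l 0 0 * l 0 1 *+ 2) (l 0 0 * l 0 2 *+ 2)
       (l 0 1 ^+ 2) (l 0 1 * l 0 2 *+ 2) (l 0 2 ^+ 2).

Lemma quad_form_double_line (l u : 'rV[F]_3) :
  quad_form (double_line l) u = (\sum_(i < 3) l 0 i * u 0 i) ^+ 2.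
Proof.
rewrite /quad_form !big_ord_recr !big_ord0 /= !mxE /=.
have -> : widen_ord (leqnSn 2) (widen_ord (leqnSn 1) ord_max) = 0 :> 'I_3.
  exact: val_inj.
have -> : widen_ord (leqnSn 2) ord_max = 1 :> 'I_3 by exact: val_inj.
have -> : ord_max = 2 :> 'I_3 by exact: val_inj.
ring.
Qed.

Definition H1 : {set {vspace 'rV[F]_6}} :=
  [set hyperplane (double_line l) | l : 'rV[F]_3 in [set~ 0]].

Definition nucleus_plane : {vspace 'rV[F]_6} :=
  (hyperplane (delta_mx 0 0)%R :&: hyperplane (delta_mx 0 3)%R
     :&: hyperplane (delta_mx 0 5)%R)%VS.

(* The conics of the Veronese surface are the images of the lines of PG(2, q). *)
Definition conics : {set {set {vspace 'rV[F]_6}}} :=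
  [set [set veronese_point P | P in points L] |
     L : {vspace 'rV[F]_3} in [set L : {vspace 'rV[F]_3} | (\dim L == 2)%N]].

Definition tangent_line (C : {set {vspace 'rV[F]_6}})
    (L : {vspace 'rV[F]_6}) : bool :=
  [&& (\dim L == 2)%N, (L <= \sum_(P in C) P)%VS & #|points L :&: C| == 1%N].

(* For q even, all the tangent lines of a conic pass through one point. *)
Definition is_nucleus (C : {set {vspace 'rV[F]_6}})
    (N : {vspace 'rV[F]_6}) : bool :=
  (\dim N == 1)%N && [forall (L | tangent_line C L), (N <= L)%VS].

(* The defaults set0 and fullv below are only used outside the intended
   domains (points of nucleus_plane, respectively planes disjoint from the
   surface and meeting nucleus_plane in a point). *)
Definition conic_of (P : {vspace 'rV[F]_6}) : {set {vspace 'rV[F]_6}} :=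
  odflt set0 [pick C in conics | is_nucleus C P].

Definition H_of_point (P : {vspace 'rV[F]_6}) : {vspace 'rV[F]_6} :=
  odflt fullv [pick H in H1 | conic_of P \subset points H].

Definition H_of_plane (pi : {vspace 'rV[F]_6}) : {vspace 'rV[F]_6} :=
  odflt fullv [pick H in H1 | (pi <= H)%VS].

Definition OD0 (pi : {vspace 'rV[F]_6}) : seq nat :=
  [:: #|[set P in points pi | point_rank P == 1%N]|;
      #|points pi :&: points nucleus_plane|;
      #|[set P in points pi | (point_rank P == 2%N)
                              && (P \notin points nucleus_plane)]|;
      #|[set P in points pi | point_rank P == 3%N]| ].

(* Trace from F to F_2, for #|F| = 2 ^ h. *)
Definition trace2 (a : F) : F := \sum_(i < logn 2 #|F|) a ^+ (2 ^ i).

(* The plane of all matrices M x y z, for M linear in (x, y, z). *)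
Definition matrix_plane (M : F -> F -> F -> 'M[F]_3) : {vspace 'rV[F]_6} :=
  <<[seq sym_coords (M t.1.1 t.1.2 t.2) | t : F * F * F]>>%VS.

Definition rep21 (a : F) : {vspace 'rV[F]_6} :=
  matrix_plane (fun x y z => mx3 [:: [:: x;         x + a * z; 0];
                                     [:: x + a * z; z;         y];
                                     [:: 0;         y;         0]]).

Definition rep22 : {vspace 'rV[F]_6} :=
  matrix_plane (fun x y z => mx3 [:: [:: x;     x + z; z];
                                     [:: x + z; z;     y];
                                     [:: z;     y;     0]]).

Definition rep23 (a : F) : {vspace 'rV[F]_6} :=
  matrix_plane (fun x y z => mx3 [:: [:: x;     a * z; x];
                                     [:: a * z; z;     y];
                                     [:: x;     y;     0]]).

End VeroneseSurface.

Arguments veronese_surface F : clear implicits.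
Arguments nucleus_plane F : clear implicits.
Arguments rep22 F : clear implicits.

(* Main.v *)
Require Import Defs.
From HB Require Import structures.
From mathcomp Require Import all_boot all_order all_algebra all_field.
From mathcomp Require Import ring.

Set Implicit Arguments.
Unset Strict Implicit.
Unset Printing Implicit Defensive.

Import GRing.Theory.
Local Open Scope ring_scope.

(* The diagonal of a symmetric matrix M transforms under M |-> A M A^T through
   the Frobenius twist of A, so the hyperplanes of H_1 are the linear conditions
   on the diagonal, Z(l_0^2 Y_0 + l_1^2 Y_3 + l_2^2 Y_5). Such a pi has a
   two-dimensional space of diagonals, so it lies in exactly one of them, with
   line l, whereas H(P) has line m = ker P. When l <> m one can move l to X_2 and
   m to X_0; then pi consists of the matrices
     [x, s, t; s, z, y; t, y, 0],  s = c x + c' z,  t = b x + b' z,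
   which have determinant x y^2 + z t^2 and rank 1 only if y = t = 0 and
   s^2 = x z. The matrices A fixing l and m reduce the pair of binary forms
   (s, t) to one of three shapes, according to whether t is zero, a multiple of
   x, or neither; for t = 0 the remaining invariant is the Artin-Schreier class
   of c c'. The first and the third orbit have the same point distribution, but
   only in the first one does pi contain a line of matrices with a common
   kernel vector. *)

Lemma addr_eq0_pchar2 (R : nzRingType) (charR2 : 2%N \in [pchar R]) (a b : R) :
  a + b = 0 -> a = b.
Proof. by move/eqP; rewrite addr_eq0 (oppr_pchar2 charR2) => /eqP. Qed.

Lemma even_eq0 (R : nzRingType) (charR2 : 2%N \in [pchar R]) :
  [/\ 2%:R = 0 :> R, 4%:R = 0 :> R, 6%:R = 0 :> R & 8%:R = 0 :> R].
Proof.
have e n : (2 * n)%:R = 0 :> R by rewrite natrM (pcharf0 charR2) mul0r.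
by split; [exact: (e 1%N) | exact: (e 2) | exact: (e 3) | exact: (e 4)].
Qed.

(* [ring] rewrites only with monomial hypotheses, hence the detour through
   a + b = 0 and the list of small even numbers. *)
Ltac ring2 c :=
  apply: (addr_eq0_pchar2 c); rewrite ?(oppr_pchar2 c);
  let c2 := fresh in let c4 := fresh in let c6 := fresh in let c8 := fresh in
  have [c2 c4 c6 c8] := even_eq0 c; ring: c2 c4 c6 c8.

Ltac field2 c :=
  apply: (addr_eq0_pchar2 c); rewrite ?(oppr_pchar2 c);
  let c2 := fresh in let c4 := fresh in let c6 := fresh in let c8 := fresh in
  have [c2 c4 c6 c8] := even_eq0 c; field: c2 c4 c6 c8.

(** * Symmetric matrices in coordinates *)

Section Coordinates.

Variable F : finFieldType.
Implicit Types (u w l m : 'rV[F]_3) (v : 'rV[F]_6) (A B : 'M[F]_3).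

Lemma sum3E (R : nmodType) (f : 'I_3 -> R) : \sum_(i < 3) f i = f 0 + f 1 + f 2.
Proof.
rewrite !big_ord_recr big_ord0 /= add0r.
by congr (f _ + f _ + f _); apply: val_inj.
Qed.

Lemma eq_row3 u w : u 0 0 = w 0 0 -> u 0 1 = w 0 1 -> u 0 2 = w 0 2 -> u = w.
Proof.
move=> h0 h1 h2; apply/rowP => -[[|[|[|//]]] i]; [move: h0|move: h1|move: h2];
by congr (u _ _ = w _ _); apply: val_inj.
Qed.

Lemma eq_row6 v v' :
  v 0 0 = v' 0 0 -> v 0 1 = v' 0 1 -> v 0 2 = v' 0 2 ->
  v 0 3 = v' 0 3 -> v 0 4 = v' 0 4 -> v 0 5 = v' 0 5 -> v = v'.
Proof.
move=> h0 h1 h2 h3 h4 h5; apply/rowP => -[[|[|[|[|[|[|//]]]]]] i];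
  [move: h0|move: h1|move: h2|move: h3|move: h4|move: h5];
by congr (v _ _ = v' _ _); apply: val_inj.
Qed.

Lemma row6K v : row6 (v 0 0) (v 0 1) (v 0 2) (v 0 3) (v 0 4) (v 0 5) = v.
Proof. by apply: eq_row6; rewrite mxE. Qed.

Lemma sym_coordsK A : A^T = A -> sym_mx (sym_coords A) = A.
Proof.
move=> symA; have s i j : A i j = A j i by rewrite -{1}symA mxE.
apply/matrixP => i j; rewrite !mxE.
case: i => [[|[|[|//]]] i]; case: j => [[|[|[|//]]] j];
  rewrite /= ?mxE /=; by [congr (A _ _); apply: val_inj
    | rewrite s; congr (A _ _); apply: val_inj].
Qed.

Lemma sym_mx_tr v : (sym_mx v)^T = sym_mx v.
Proof.
by apply/matrixP => -[[|[|[|//]]] i] [[|[|[|//]]] j]; rewrite !mxE.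
Qed.

Lemma sym_mx_Kmap A v : sym_mx (Kmap A v) = A *m sym_mx v *m A^T.
Proof. by rewrite sym_coordsK // !trmx_mul trmxK sym_mx_tr mulmxA. Qed.

Lemma Kmap1 v : Kmap 1%:M v = v.
Proof. by rewrite /Kmap trmx1 mul1mx mulmx1 sym_mxK. Qed.

Lemma Kmap_mul A B v : Kmap A (Kmap B v) = Kmap (A *m B) v.
Proof. by rewrite /Kmap sym_mx_Kmap trmx_mul !mulmxA. Qed.

(** [f i j] is the (i, j) entry of A M A^T written out, so that identities about the action become
    goals for [ring]. *)
Lemma Kmap_coordsE A v (f := fun i j =>
    A i 0 * v 0 0 * A j 0 + A i 0 * v 0 1 * A j 1 + A i 0 * v 0 2 * A j 2 +
    A i 1 * v 0 1 * A j 0 + A i 1 * v 0 3 * A j 1 + A i 1 * v 0 4 * A j 2 +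
    A i 2 * v 0 2 * A j 0 + A i 2 * v 0 4 * A j 1 + A i 2 * v 0 5 * A j 2) :
  Kmap A v = row6 (f 0 0) (f 0 1) (f 0 2) (f 1 1) (f 1 2) (f 2 2).
Proof.
have e i j : (A *m sym_mx v *m A^T) i j = f i j.
  by rewrite !(mxE, sum3E) /= /f; ring.
by rewrite /Kmap /sym_coords !e.
Qed.

End Coordinates.

(** * Points and orbits *)

Section Lines.

Variables (F : fieldType) (vT : vectType F).
Implicit Types (v w : vT) (U : {vspace vT}).

Lemma vline_scale v (a : F) : a != 0 -> <[a *: v]>%VS = <[v]>%VS.
Proof.
move=> a0; apply/eqP; rewrite eqEsubv -!memvE; apply/andP; split.
  by rewrite memvZ ?memv_line.
by rewrite -[v in v \in _](scalerK a0) memvZ ?memv_line.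
Qed.

Lemma memvZE (a : F) v U : a != 0 -> (a *: v \in U) = (v \in U).
Proof. by move=> a0; rewrite !memvE vline_scale. Qed.

Lemma vpick_line v : v != 0 -> exists2 a : F, a != 0 & vpick <[v]> = a *: v.
Proof.
move=> v0; have [a ea] := vlineP _ _ (memv_pick <[v]>%VS); exists a => //.
apply: contra_neq v0 => a0; apply/eqP.
by move: ea; rewrite a0 scale0r => /eqP; rewrite vpick0 -dimv_eq0 dim_vline eqb0 negbK.
Qed.

Lemma dim1_vpick U : \dim U = 1%N -> vpick U != 0 /\ U = <[vpick U]>%VS.
Proof.
move=> dU; have p0 : vpick U != 0 by rewrite vpick0 -dimv_eq0 dU.
by split=> //; apply/eqP; rewrite eq_sym eqEdim -memvE memv_pick dU dim_vline p0.
Qed.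

End Lines.

Section Points.

Variable F : finFieldType.

Lemma mem_pointsP n (U P : {vspace 'rV[F]_n}) :
  reflect (exists v, [/\ v != 0, v \in U & P = <[v]>%VS]) (P \in points U).
Proof.
rewrite inE; apply: (iffP andP) => [[/eqP d1 sPU]|[v [v0 vU ->]]].
  have [p0 eP] := dim1_vpick d1; exists (vpick P); split=> //.
  by apply: (subvP sPU); apply: memv_pick.
by rewrite dim_vline v0 -memvE.
Qed.

Lemma mem_points_line n (U : {vspace 'rV[F]_n}) v :
  v != 0 -> (<[v]>%VS \in points U) = (v \in U).
Proof. by move=> v0; rewrite inE dim_vline v0 -memvE. Qed.

(** A point holds q - 1 nonzero vectors, and a scale-invariant [Q] does not see which of them
    [vpick] returns. Keeping the factor q - 1 turns counts of points into counts of vectors without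
    a division. *)
Lemma card_points_scale n (U : {vspace 'rV[F]_n}) (Q : pred 'rV[F]_n) :
    (forall (a : F) v, a != 0 -> Q (a *: v) = Q v) ->
  (#|[set P in points U | Q (vpick P)]| * #|F|.-1)%N =
    #|[set v : 'rV[F]_n | [&& v \in U, v != 0 & Q v]]|.
Proof.
move=> QZ; rewrite -sum_nat_const -sum1_card.
rewrite (partition_big (fun v => <[v]>%VS) (mem [set P in points U | Q (vpick P)])) /=.
  apply: eq_bigr => P; rewrite !inE => /andP[/andP[/eqP dP sPU] QP].
  have [p0 eP] := dim1_vpick dP.
  rewrite sum1dep_card -(cardC1 (0 : F)).
  rewrite -(@card_imset _ _ (fun a : F => a *: vpick P) (predC1 0)); last first.
    move=> a b /eqP; rewrite -subr_eq0 -scalerBl scaler_eq0 (negPf p0) orbF.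
    by rewrite subr_eq0 => /eqP.
  apply: eq_card => v; rewrite !inE; apply/imsetP/idP => [[a]|].
    rewrite inE => a0 ->; rewrite scaler_eq0 negb_or a0 p0 QZ // QP.
    by rewrite vline_scale // -eP eqxx memvZ // (subvP sPU) ?memv_pick.
  case/andP=> /and3P[vU v0 Qv] /eqP ev.
  have /vlineP[a ea] : v \in <[vpick P]>%VS by rewrite -eP -ev memv_line.
  by exists a => //; rewrite inE; apply: contraNneq v0; rewrite ea => ->; rewrite scale0r.
move=> v; rewrite inE => /and3P[vU v0 Qv]; rewrite inE mem_points_line // vU.
by have [a a0 ->] := vpick_line v0; rewrite QZ.
Qed.

Lemma veroneseZ (a : F) u : veronese (a *: u) = a ^+ 2 *: veronese u.
Proof. by apply: eq_row6; rewrite !mxE /=; ring. Qed.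

Lemma veronese_eq0 (u : 'rV[F]_3) : (veronese u == 0) = (u == 0).
Proof.
apply/eqP/eqP => [/rowP h | ->]; last by apply: eq_row6; rewrite !mxE /=; ring.
have := (h 0, h 3, h 5); rewrite !mxE /=.
case=> -[] /eqP; rewrite expf_eq0 => /eqP h0 /eqP; rewrite expf_eq0 => /eqP h1.
by move=> /eqP; rewrite expf_eq0 => /eqP h2; apply: eq_row3; rewrite mxE.
Qed.

Lemma veronese_line (u : 'rV[F]_3) :
  u != 0 -> veronese_point <[u]> = <[veronese u]>%VS.
Proof.
move=> u0; have [a a0 e] := vpick_line u0.
by rewrite /veronese_point e veroneseZ vline_scale // expf_neq0.
Qed.

End Points.

Section Action.

Variable F : finFieldType.
Implicit Types (U V W : {vspace 'rV[F]_6}) (A B : 'M[F]_3).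

Lemma memKact A U (v : 'rV[F]_6) : v \in U -> Kmap A v \in Kact A U.
Proof. by move=> vU; rewrite -(lfunE (Kmap A)) memv_img. Qed.

Lemma memKactP A U (v : 'rV[F]_6) :
  reflect (exists2 w, w \in U & v = Kmap A w) (v \in Kact A U).
Proof.
apply: (iffP memv_imgP) => -[w wU ->]; exists w => //; first exact: (lfunE (Kmap A)).
by rewrite (lfunE (Kmap A)).
Qed.

Lemma Kact1 U : Kact 1%:M U = U.
Proof.
apply/vspaceP => v; apply/memKactP/idP => [[w wU ->]|vU]; first by rewrite Kmap1.
by exists v; rewrite ?Kmap1.
Qed.

Lemma Kact_mul A B U : Kact A (Kact B U) = Kact (A *m B) U.
Proof.
apply/vspaceP => v; apply/memKactP/memKactP => [[_ /memKactP[w wU ->] ->]|[w wU ->]].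
  by exists w; rewrite ?Kmap_mul.
by exists (Kmap B w); rewrite ?memKact ?Kmap_mul.
Qed.

Lemma KmapK A : A \in unitmx -> cancel (Kmap A) (Kmap (invmx A)).
Proof. by move=> uA v; rewrite Kmap_mul mulVmx ?Kmap1. Qed.

Lemma Kmap_eq0 A v : A \in unitmx -> (Kmap A v == 0) = (v == 0).
Proof. by move=> uA; rewrite -[in RHS](inj_eq (can_inj (KmapK uA))) linear0. Qed.

Lemma KactK A : A \in unitmx -> cancel (Kact A) (Kact (invmx A)).
Proof. by move=> uA U; rewrite Kact_mul mulVmx ?Kact1. Qed.

Lemma dim_Kact A U : A \in unitmx -> \dim (Kact A U) = \dim U.
Proof.
move=> uA; apply: limg_dim_eq.
suff /lker0P/eqP -> : injective (linfun (Kmap A)) by rewrite capv0.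
by move=> v w; rewrite !(lfunE (Kmap A)) => /(can_inj (KmapK uA)).
Qed.

Lemma Korbit_refl U : U \in Korbit U.
Proof.
by apply/imsetP; exists 1%:M; rewrite ?Kact1 // -[_ \in _]/(1%:M \in unitmx) unitmx1.
Qed.

Lemma Korbit_Kact A U : A \in unitmx -> Kact A U \in Korbit U.
Proof. by move=> uA; apply/imsetP; exists A. Qed.

Lemma Korbit_sym U V : V \in Korbit U -> U \in Korbit V.
Proof.
by case/imsetP => A uA ->; apply/imsetP; exists (invmx A); rewrite ?KactK // unitmx_inv.
Qed.

Lemma Korbit_trans U V W : V \in Korbit U -> W \in Korbit V -> W \in Korbit U.
Proof.
case/imsetP => A uA -> /imsetP[B uB ->]; rewrite Kact_mul Korbit_Kact //.
by rewrite unitmx_mul uA uB.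
Qed.

Lemma Kact_eq A U V :
    A \in unitmx -> \dim U = \dim V -> (forall v, v \in U -> Kmap A v \in V) ->
  Kact A U = V.
Proof.
move=> uA dUV sUV; apply/eqP; rewrite eqEdim dim_Kact // dUV leqnn andbT.
by apply/subvP => _ /memKactP[v vU ->]; apply: sUV.
Qed.

End Action.

(** * Trace and Artin-Schreier equation *)

Section EvenCharacteristic.

Variables (F : finFieldType) (charF2 : 2%N \in [pchar F]).

Lemma sqrD_pchar2 (x y : F) : (x + y) ^+ 2 = x ^+ 2 + y ^+ 2.
Proof. by ring2 charF2. Qed.

Lemma sqr_inj_pchar2 : injective (fun x : F => x ^+ 2).
Proof.
move=> x y /= e; apply: (addr_eq0_pchar2 charF2); apply/eqP.
by rewrite -sqrf_eq0 sqrD_pchar2 e (addrr_pchar2 charF2).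
Qed.

Lemma sqrt_pchar2 (x : F) : exists y, y ^+ 2 = x.
Proof. by have [g _ gK] := injF_bij sqr_inj_pchar2; exists (g x); apply: gK. Qed.

Lemma card_pchar2 : exists h : nat, #|F| = (2 ^ h.+1)%N.
Proof.
have := card_pprimeChar charF2; have := finNzRing_gt1 F.
by case: (logn _ _) => [|h] gt1 cF; [rewrite cF in gt1 | exists h].
Qed.

Lemma trace2D (x y : F) : trace2 (x + y) = trace2 x + trace2 y.
Proof.
rewrite /trace2 -big_split /=; apply: eq_bigr => i _.
elim: (nat_of_ord i) => [|n IH]; first by rewrite !expr1.
by rewrite expnSr !exprM IH sqrD_pchar2.
Qed.

(** Squaring shifts the summands x^(2^i) cyclically, because x^q = x. *)
Lemma trace2_sqr (x : F) : trace2 (x ^+ 2) = trace2 x.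
Proof.
have [h eh] := card_pchar2; rewrite /trace2 eh pfactorK //.
rewrite big_ord_recr [RHS]big_ord_recl /= expr1 addrC.
rewrite -exprM -expnS -eh expf_card; congr (_ + _).
by apply: eq_bigr => i _; rewrite -exprM -expnS.
Qed.

Lemma sqr_trace2 (x : F) : trace2 x ^+ 2 = trace2 (x ^+ 2).
Proof.
rewrite /trace2; elim/big_rec2: _ => [|i y z _ <-]; first by rewrite expr0n.
by rewrite sqrD_pchar2 -!exprM mulnC.
Qed.

Lemma trace2_01 (x : F) : trace2 x = 0 \/ trace2 x = 1.
Proof.
have : trace2 x * (trace2 x - 1) = 0.
  by rewrite mulrBr mulr1 -expr2 sqr_trace2 trace2_sqr subrr.
by move/eqP; rewrite mulf_eq0 subr_eq0 => /orP[] /eqP; [left | right].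
Qed.

Lemma card_trace2_ker h :
  #|F| = (2 ^ h.+1)%N -> (#|[set x : F | trace2 x == 0%R]| <= 2 ^ h)%N.
Proof.
move=> eh; pose p : {poly F} := \sum_(i < h.+1) 'X^(2 ^ i).
have sp : size p = (2 ^ h).+1.
  rewrite /p big_ord_recr /= addrC size_polyDl size_polyXn //.
  apply: leq_ltn_trans (size_sum _ _ _) _; rewrite ltnS.
  by apply/bigmax_leqP => i _; rewrite size_polyXn ltn_exp2l.
have p0 : p != 0 by rewrite -size_poly_eq0 sp.
rewrite cardE -ltnS -sp; apply: (max_poly_roots p0); last exact: enum_uniq.
apply/allP => x; rewrite mem_enum inE /trace2 eh pfactorK // /root /p horner_sum.
by move/eqP => e; apply/eqP; rewrite -[RHS]e; apply: eq_bigr => i _; rewrite hornerXn.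
Qed.

Lemma artin_schreier_fiber (u v : F) :
  u ^+ 2 + u = v ^+ 2 + v -> (u == v) || (u == v + 1).
Proof.
move=> e; have /eqP : (u - v) * (u - (v + 1)) = 0.
  transitivity ((u ^+ 2 + u) - (v ^+ 2 + v)); first by ring2 charF2.
  by rewrite e subrr.
by rewrite mulf_eq0 !subr_eq0.
Qed.

(* Additive Hilbert 90, by counting: the fibres of u |-> u ^+ 2 + u have two
   elements, and the trace is a polynomial of degree #|F| / 2. *)
Lemma trace2_eq0 (x : F) : trace2 x = 0 -> exists u, u ^+ 2 + u = x.
Proof.
move=> tx; have [h eh] := card_pchar2.
pose I := [set u ^+ 2 + u | u : F].
have sI : I \subset [set x : F | trace2 x == 0].
  apply/subsetP => _ /imsetP[u _ ->]; rewrite inE trace2D trace2_sqr.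
  by rewrite (addrr_pchar2 charF2).
have cI : (2 ^ h.+1 <= #|I| * 2)%N.
  rewrite -eh -sum_nat_const -sum1_card.
  rewrite (partition_big (fun u : F => u ^+ 2 + u) (mem I)) /=; last first.
    by move=> u _; apply: imset_f.
  apply: leq_sum => _ /imsetP[v _ ->]; rewrite sum1dep_card.
  apply: (@leq_trans #|[set v; (v + 1)%R]|); last by rewrite cards2; case: (_ == _).
  by apply/subset_leq_card/subsetP => u; rewrite !inE => /eqP/artin_schreier_fiber.
have /eqP eI : I == [set x : F | trace2 x == 0].
  rewrite eqEcard sI; apply: leq_trans (card_trace2_ker eh) _.
  by move: cI; rewrite expnSr leq_pmul2r.
have : x \in I by rewrite eI inE tx.
by case/imsetP => u _ ->; exists u.
Qed.

(** An identically zero trace would have q zeros, while [card_trace2_ker] allows at most q/2. *)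
Lemma ex_trace2_eq1 : exists a : F, trace2 a = 1.
Proof.
have [h eh] := card_pchar2.
have [a ta | ] := pickP (fun a : F => trace2 a != 0).
  by exists a; have [t0|//] := trace2_01 a; rewrite t0 eqxx in ta.
move=> t0; have := card_trace2_ker eh.
rewrite (_ : [set _ | _] = setT) ?cardsT ?eh ?leq_exp2l ?ltnn //.
by apply/setP => x; rewrite !inE; apply/negPn; rewrite t0.
Qed.

Lemma trace2_eq1_neq (a u : F) : trace2 a = 1 -> u ^+ 2 + u <> a.
Proof.
move=> ta e; move: ta; rewrite -e trace2D trace2_sqr (addrr_pchar2 charF2).
by move/esym/eqP; rewrite oner_eq0.
Qed.

Lemma trace2_neq0 (a : F) : trace2 a = 1 -> a != 0.
Proof. by move=> ta; apply/eqP => a0; apply: (trace2_eq1_neq (u := 0) ta); rewrite a0; ring. Qed.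

End EvenCharacteristic.

(** * Planes in normal form *)

Lemma det3E (R : comNzRingType) (A : 'M[R]_3) :
  \det A = A 0 0 * (A 1 1 * A 2 2 - A 1 2 * A 2 1)
         - A 0 1 * (A 1 0 * A 2 2 - A 1 2 * A 2 0)
         + A 0 2 * (A 1 0 * A 2 1 - A 1 1 * A 2 0).
Proof.
have d2 (B : 'M[R]_2) : \det B = B 0 0 * B 1 1 - B 0 1 * B 1 0.
  rewrite (expand_det_row _ 0) !big_ord_recl big_ord0 /cofactor !det_mx11 !mxE /=.
  have e0 : lift (0 : 'I_2) 0 = 1 :> 'I_2 by apply: val_inj.
  have e1 : lift (1 : 'I_2) 0 = 0 :> 'I_2 by apply: val_inj.
  by rewrite ?e0 ?e1 /bump /= !expr0 !expr1 addr0 !mul1r mulN1r mulrN; congr (_ * _ - _ * _);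
   congr (B _ _); apply: val_inj.
rewrite (expand_det_row _ 0) sum3E /cofactor !d2 !mxE.
have e00 : lift (0 : 'I_3) (0 : 'I_2) = 1 :> 'I_3 by apply: val_inj.
have e01 : lift (0 : 'I_3) (1 : 'I_2) = 2 :> 'I_3 by apply: val_inj.
have e10 : lift (1 : 'I_3) (0 : 'I_2) = 0 :> 'I_3 by apply: val_inj.
have e11 : lift (1 : 'I_3) (1 : 'I_2) = 2 :> 'I_3 by apply: val_inj.
have e20 : lift (2 : 'I_3) (0 : 'I_2) = 0 :> 'I_3 by apply: val_inj.
have e21 : lift (2 : 'I_3) (1 : 'I_2) = 1 :> 'I_3 by apply: val_inj.
rewrite e00 e01 e10 e11 e20 e21 /=; ring.
Qed.

Section GeneralPlanes.

Variables (F : finFieldType) (charF2 : 2%N \in [pchar F]).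

(** The normal form: these planes lie in Y_5 = 0 and contain the nucleus point Y_4. With x = Y_0, z
    = Y_3 and y = Y_4 as parameters, only the binary forms s and t can vary. *)
Definition gplane (c c' b b' : F) : {vspace 'rV[F]_6} :=
  matrix_plane (fun x y z => mx3 [:: [:: x; c * x + c' * z; b * x + b' * z];
                                     [:: c * x + c' * z; z; y];
                                     [:: b * x + b' * z; y; 0]]).

Definition gvec (c c' b b' x y z : F) : 'rV[F]_6 :=
  row6 x (c * x + c' * z) (b * x + b' * z) z y 0.

Lemma gplane_gvec c c' b b' :
  gplane c c' b b' =
  <<[seq gvec c c' b b' t.1.1 t.1.2 t.2 | t : F * F * F]>>%VS.
Proof.
congr (<<_>>%VS); apply: eq_map => t; apply: eq_row6; rewrite !mxE //=.
Qed.

Lemma gvec_lin c c' b b' x y z :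
  gvec c c' b b' x y z = x *: gvec c c' b b' 1 0 0 + y *: gvec c c' b b' 0 1 0
                         + z *: gvec c c' b b' 0 0 1.
Proof. by apply: eq_row6; rewrite !mxE /=; ring. Qed.

Lemma gvec_in c c' b b' x y z : gvec c c' b b' x y z \in gplane c c' b b'.
Proof.
rewrite gplane_gvec memv_span //; apply/mapP.
by exists ((x, y), z) => //; rewrite mem_enum.
Qed.

Lemma gplane_span c c' b b' :
  gplane c c' b b' = <<[:: gvec c c' b b' 1%R 0%R 0%R; gvec c c' b b' 0%R 1%R 0%R;
                           gvec c c' b b' 0%R 0%R 1%R]>>%VS.
Proof.
apply/eqP; rewrite eqEsubv; apply/andP; split; last first.
  by apply/span_subvP => v; rewrite !inE => /or3P[] /eqP ->; apply: gvec_in.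
rewrite gplane_gvec; apply/span_subvP => _ /mapP[[[x y] z] _ ->] /=.
rewrite (gvec_lin _ _ _ _ x y z).
by apply: memvD; [apply: memvD|]; rewrite memvZ // memv_span // !inE eqxx ?orbT.
Qed.

Lemma gplaneP c c' b b' v :
  reflect (exists x y z, v = gvec c c' b b' x y z) (v \in gplane c c' b b').
Proof.
apply: (iffP idP) => [|[x [y [z ->]]]]; last exact: gvec_in.
rewrite gplane_span !span_cons span_nil addv0.
case/memv_addP => _ /vlineP[x ->] [_ /memv_addP[_ /vlineP[y ->] [_ /vlineP[z ->] ->]] ->].
by exists x, y, z; rewrite [RHS]gvec_lin addrA.
Qed.

Lemma gvec_eq c c' b b' x y z x' y' z' :
  gvec c c' b b' x y z = gvec c c' b b' x' y' z' -> [/\ x = x', y = y' & z = z'].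
Proof.
by move/rowP => h; split; [have := h 0|have := h 4|have := h 3]; rewrite !mxE.
Qed.

Lemma gvec0 c c' b b' : gvec c c' b b' 0 0 0 = 0.
Proof. by apply: eq_row6; rewrite !mxE /=; ring. Qed.

Lemma dim_gplane c c' b b' : \dim (gplane c c' b b') = 3%N.
Proof.
pose X := [tuple gvec c c' b b' 1 0 0; gvec c c' b b' 0 1 0; gvec c c' b b' 0 0 1].
have fX : free X.
  apply/freeP => k; rewrite !big_ord_recl big_ord0 /= addr0 addrA.
  rewrite -[_ + _ + _]gvec_lin -(gvec0 c c' b b').
  by case/gvec_eq => h0 h1 h2 -[[|[|[|//]]] i];
    [rewrite -[RHS]h0|rewrite -[RHS]h1|rewrite -[RHS]h2];
    congr k; apply: val_inj.
by rewrite gplane_span; move: fX; rewrite /free => /eqP.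
Qed.

Lemma mem_gplane c c' b b' v :
  (v \in gplane c c' b b') =
  [&& v 0 1 == c * v 0 0 + c' * v 0 3, v 0 2 == b * v 0 0 + b' * v 0 3
    & v 0 5 == 0].
Proof.
apply/gplaneP/and3P => [[x [y [z ->]]]|[/eqP h1 /eqP h2 /eqP h5]].
  by rewrite !mxE /= !eqxx.
exists (v 0 0), (v 0 4), (v 0 3).
by rewrite -[LHS]row6K h1 h2 h5.
Qed.

Lemma gplane_rep21 a : gplane 1 a 0 0 = rep21 a.
Proof.
congr (<<_>>%VS); apply: eq_map => t; apply: eq_row6; rewrite !mxE //=; ring.
Qed.

Lemma gplane_rep22 : gplane 1 1 0 1 = rep22 F.
Proof.
congr (<<_>>%VS); apply: eq_map => t; apply: eq_row6; rewrite !mxE //=; ring.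
Qed.

Lemma gplane_rep23 a : gplane 0 a 1 0 = rep23 a.
Proof.
congr (<<_>>%VS); apply: eq_map => t; apply: eq_row6; rewrite !mxE //=; ring.
Qed.

(** The matrix [A] in the proof is the general one whose first and last rows are multiples of unit
    vectors, that is, which keeps both m and l. It sends x to x' = al^2 x and z to z' = be^2 x +
    ga^2 z; the four equations compare the coefficients of x and z in s' = C x' + C' z' and t' = B
    x' + B' z'. *)
Lemma Korbit_gplane (al be ga de ep : F) c c' b b' C C' B B' :
    al != 0 -> ga != 0 -> ep != 0 ->
    al * (be + ga * c + de * b) = C * al ^+ 2 + C' * be ^+ 2 ->
    al * (ga * c' + de * b') = C' * ga ^+ 2 ->
    al * ep * b = B * al ^+ 2 + B' * be ^+ 2 ->
    al * ep * b' = B' * ga ^+ 2 ->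
  gplane c c' b b' \in Korbit (gplane C C' B B').
Proof.
move=> al0 ga0 ep0 e1 e2 e3 e4; apply: Korbit_sym.
pose A : 'M[F]_3 := mx3 [:: [:: al; 0; 0]; [:: be; ga; de]; [:: 0; 0; ep]].
have uA : A \in unitmx.
  rewrite unitmxE det3E !mxE /= unitfE.
  by rewrite (_ : _ + _ = al * ga * ep); [rewrite !mulf_neq0 | ring].
suff <- : Kact A (gplane c c' b b') = gplane C C' B B' by apply: Korbit_Kact.
apply: Kact_eq; rewrite ?dim_gplane // => v; rewrite !mem_gplane.
case/and3P => /eqP h1 /eqP h2 /eqP h5; rewrite Kmap_coordsE !mxE /= h1 h2 h5.
apply/and3P; split; apply/eqP.
- transitivity (al * (be + ga * c + de * b) * v 0 0 + al * (ga * c' + de * b') * v 0 3);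
    first by ring2 charF2.
  by rewrite e1 e2; ring2 charF2.
- transitivity (al * ep * b * v 0 0 + al * ep * b' * v 0 3); first by ring2 charF2.
  by rewrite e3 e4; ring2 charF2.
- ring2 charF2.
Qed.

End GeneralPlanes.

(** * Normal forms without rank-1 points, up to the group K *)

Lemma rank1_minors (F : fieldType) m n (A : 'M[F]_(m, n)) i j k l :
  \rank A = 1%N -> A i j * A k l = A i l * A k j.
Proof.
move=> rA; have := mulmx_base A; move: (col_base A) (row_base A); rewrite rA.
by move=> C R <-; rewrite !mxE !big_ord_recl !big_ord0; ring.
Qed.

Lemma rank3_det (F : fieldType) (A : 'M[F]_3) : (\rank A == 3%N) = (\det A != 0).
Proof. by rewrite -[_ == _]/(row_free A) row_free_unit unitmxE unitfE. Qed.

Section PlaneOrbits.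

Variables (F : finFieldType) (charF2 : 2%N \in [pchar F]).

(** Disjointness from the Veronese surface in coordinates: t = 0 and s^2 = x z are the rank-1
    conditions that remain once y = 0. *)
Definition no_rank1 (c c' b b' : F) : Prop :=
  forall x z : F, b * x + b' * z = 0 -> (c * x + c' * z) ^+ 2 = x * z ->
  x = 0 /\ z = 0.

(** For z nonzero, division by z^2 gives u^2 + u = a^2 with u = x / z, although a^2 has trace 1. For
    z = 0 the equation reads x^2 = 0. *)
Lemma no_rank1_rep21 (a : F) : trace2 a = 1 -> no_rank1 1 a 0 0.
Proof.
move=> ta x z _ e.
have z0 : z = 0.
  apply/eqP; apply/negPn/negP => z0.
  apply: (@trace2_eq1_neq F charF2 (a ^+ 2) (x / z)); first by rewrite trace2_sqr.
  have -> : a ^+ 2 = (1 * x + a * z) ^+ 2 / z ^+ 2 + (x / z) ^+ 2 by field2 charF2.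
  by rewrite e; field.
by split=> //; move: e; rewrite z0 !mulr0 addr0 mul1r => /eqP; rewrite sqrf_eq0 => /eqP.
Qed.

Lemma no_rank1_rep22 : no_rank1 1 1 0 1.
Proof.
move=> x z; rewrite mul0r mul1r add0r => ->; rewrite mulr0 mul1r addr0 => /eqP.
by rewrite sqrf_eq0 => /eqP.
Qed.

Lemma no_rank1_rep23 (a : F) : a != 0 -> no_rank1 0 a 1 0.
Proof.
move=> a0 x z; rewrite mul0r mul1r addr0 => ->; rewrite !mul0r add0r => /eqP.
by rewrite sqrf_eq0 mulf_eq0 (negPf a0) /= => /eqP.
Qed.

Lemma gplane_Korbit22 c c' b b' :
  no_rank1 c c' b b' -> b' != 0 -> gplane c c' b b' \in Korbit (rep22 F).
Proof.
(* The form t vanishes at (x, z) = (1, r^2). Taking [be] = r makes z' vanish there too, so that t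
   becomes a multiple of z'. *)
move=> nr b'0; rewrite -gplane_rep22; have [r er] := sqrt_pchar2 charF2 (b / b').
have eb : b = r ^+ 2 * b' by rewrite er divfK.
(* This value of [al] is forced by the coefficient of x in s'. If it were 0, then s = r at (1, r^2),
   where t = 0, and s^2 = x z would contradict [no_rank1]. *)
have [al eal] : exists al, r + c + c' * r ^+ 2 = al by eexists.
have al0 : al != 0.
  apply/eqP => al0; have e := addr_eq0_pchar2 charF2 (etrans eal al0).
  have [||/eqP] := nr 1 (r ^+ 2).
  - by rewrite eb; ring2 charF2.
  - by rewrite -e; ring2 charF2.
  - by rewrite oner_eq0.
(* [de] is solved from the condition that z has coefficient 1 in s', and [ep] from t' = z'. *)
apply: (@Korbit_gplane F charF2 al r 1 ((al^-1 + c') / b') (al^-1 / b'));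
  rewrite ?mulf_neq0 ?invr_eq0 ?oner_eq0 //.
- transitivity (al * (r + c + c' * r ^+ 2) + r ^+ 2); last by rewrite eal; ring2 charF2.
  by rewrite eb; field2 charF2; rewrite b'0 al0.
- by field2 charF2; rewrite b'0 al0.
- by rewrite eb; field2 charF2; rewrite b'0 al0.
- by field2 charF2; rewrite b'0 al0.
Qed.

(** Here t = b x: adding a multiple of t to s clears its x-term ([de]), [al] turns c' into a, and
    [ep] turns b into 1. In particular all nonzero a give one orbit. *)
Lemma gplane_Korbit23 (a c c' b : F) :
  a != 0 -> c' != 0 -> b != 0 -> gplane c c' b 0 \in Korbit (rep23 a).
Proof.
move=> a0 c'0 b0; rewrite -gplane_rep23.
by apply: (@Korbit_gplane F charF2 (a / c') 0 1 (c / b) (a / c' / b));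
  rewrite ?mulf_neq0 ?invr_eq0 ?oner_eq0 //; field2 charF2; rewrite ?c'0 ?b0.
Qed.

(** For t = 0, the entry [be] = u / c' changes the product c c' by u^2 + u. Since c c' and a have
    the same trace, a suitable u exists by additive Hilbert 90, and [al] = a / c' normalises the
    coefficients. *)
Lemma gplane_Korbit21 (a c c' : F) :
    c != 0 -> c' != 0 -> trace2 (c * c') = 1 -> trace2 a = 1 ->
  gplane c c' 0 0 \in Korbit (rep21 a).
Proof.
move=> c0 c'0 tc ta; rewrite -gplane_rep21.
have [u eu] : exists u, u ^+ 2 + u = c * c' + a.
  by apply: trace2_eq0 => //; rewrite trace2D // tc ta (addrr_pchar2 charF2).
have ea : a = u ^+ 2 + u + c * c' by rewrite eu; ring2 charF2.
apply: (@Korbit_gplane F charF2 (a / c') (u / c') 1 0 1);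
  rewrite ?mulf_neq0 ?invr_eq0 ?oner_eq0 ?(trace2_neq0 charF2 ta) //.
- by rewrite ea; field2 charF2.
- by field2 charF2.
- by ring.
- by ring.
Qed.

Lemma no_rank1_trace2 c c' :
  no_rank1 c c' 0 0 -> [/\ c != 0, c' != 0 & trace2 (c * c') = 1].
Proof.
move=> nr.
have c0 : c != 0.
  apply/eqP => c0; have [||/eqP] := nr 1 0; rewrite ?oner_eq0 ?c0 //; ring.
have c'0 : c' != 0.
  apply/eqP => c0'; have [||_ /eqP] := nr 0 1; rewrite ?oner_eq0 ?c0' //; ring.
split=> //; have [t0|//] := trace2_01 charF2 (c * c').
rewrite -(trace2_sqr charF2) in t0.
have [u eu] := trace2_eq0 charF2 t0.
(* With u^2 + u = (c c')^2, the choice x = u / c^2, z = 1 gives s^2 = (u^2 + (c c')^2) / c^2 = u /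
   c^2 = x z. *)
have [||_ /eqP] := nr (u / c ^+ 2) 1; rewrite ?oner_eq0 //; first by ring.
have -> : (c * (u / c ^+ 2) + c' * 1) ^+ 2 = (u ^+ 2 + (c * c') ^+ 2) / c ^+ 2.
  by field2 charF2.
rewrite -eu; by field2 charF2.
Qed.

Lemma gplane_Korbits a c c' b b' :
    trace2 a = 1 -> no_rank1 c c' b b' ->
  [\/ gplane c c' b b' \in Korbit (rep21 a), gplane c c' b b' \in Korbit (rep22 F)
    | gplane c c' b b' \in Korbit (rep23 a)].
Proof.
move=> ta nr; have [b'0|b'0] := eqVneq b' 0; last by constructor 2; apply: gplane_Korbit22.
rewrite b'0 in nr *; have [b0|b0] := eqVneq b 0.
  rewrite b0 in nr *; have [c0 c'0 tc] := no_rank1_trace2 nr.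
  by constructor 1; apply: gplane_Korbit21.
constructor 3; apply: gplane_Korbit23 => //; first exact: (trace2_neq0 charF2 ta).
(* If c' were 0 as well, s and t would both vanish at (x, z) = (0, 1). *)
by apply/eqP => c0'; have [||_ /eqP] := nr 0 1; rewrite ?oner_eq0 ?c0' //; ring.
Qed.

End PlaneOrbits.

(** * Point distributions *)

Section Distribution.

Variables (F : finFieldType) (charF2 : 2%N \in [pchar F]).
Implicit Types (U : {vspace 'rV[F]_6}) (v : 'rV[F]_6).

Lemma mem_hyperplane a v :
  (v \in hyperplane a) =
  (v 0 0 * a 0 0 + v 0 1 * a 0 1 + v 0 2 * a 0 2 + v 0 3 * a 0 3 + v 0 4 * a 0 4
   + v 0 5 * a 0 5 == 0).
Proof.
have -> : (v \in hyperplane a) = ((v *m a^T) 0 0 == 0).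
  rewrite memv_ker lfunE /=; apply/eqP/eqP => [->|h]; first by rewrite mxE.
  by apply/matrixP => i j; rewrite !ord1 h mxE.
rewrite mxE !big_ord_recr big_ord0 /= add0r !mxE.
by congr (v _ _ * a _ _ + v _ _ * a _ _ + v _ _ * a _ _ + v _ _ * a _ _ + v _ _ * a _ _
   + v _ _ * a _ _ == 0); apply: val_inj.
Qed.

Lemma mem_nucleus_plane v :
  (v \in nucleus_plane F) = [&& v 0 0 == 0, v 0 3 == 0 & v 0 5 == 0].
Proof.
rewrite !memv_cap !mem_hyperplane !mxE /= -andbA.
by rewrite !mulr0 !mulr1 !addr0 !add0r.
Qed.

(** In characteristic 2 the diagonal of A M A^T depends only on the diagonal of M, so a zero
    diagonal stays zero; [invmx A] gives the converse. *)
Lemma mem_nucleus_Kmap (A : 'M[F]_3) v :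
  A \in unitmx -> (Kmap A v \in nucleus_plane F) = (v \in nucleus_plane F).
Proof.
have nuc B w : w \in nucleus_plane F -> Kmap B w \in nucleus_plane F.
  rewrite !mem_nucleus_plane => /and3P[/eqP h0 /eqP h3 /eqP h5].
  rewrite Kmap_coordsE !mxE /= h0 h3 h5.
  by apply/and3P; split; apply/eqP; ring2 charF2.
by move=> uA; apply/idP/idP => /nuc; [move/(_ (invmx A)); rewrite KmapK | apply].
Qed.

Lemma sym_mxZ (a : F) v : sym_mx (a *: v) = a *: sym_mx v.
Proof. by apply/matrixP => -[[|[|[|//]]] i] [[|[|[|//]]] j]; rewrite !mxE /= ?mxE. Qed.

Lemma rank_sym_mxZ (a : F) v : a != 0 -> \rank (sym_mx (a *: v)) = \rank (sym_mx v).
Proof. by move=> a0; rewrite sym_mxZ mxrank_scale_nz. Qed.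

Lemma rank_Kmap (A : 'M[F]_3) v :
  A \in unitmx -> \rank (sym_mx (Kmap A v)) = \rank (sym_mx v).
Proof.
move=> uA; rewrite sym_mx_Kmap mxrankMfree ?row_free_unit ?unitmx_tr //.
by rewrite eqmxMfull // row_full_unit.
Qed.

(** All four entries of [OD0] have this form, so their K-invariance is proved once, for a predicate
    on vectors. *)
Definition npoints U (Q : pred 'rV[F]_6) : nat :=
  #|[set P in points U | Q (vpick P)]|.

Lemma OD0E U : OD0 U =
  [:: npoints U (fun v => \rank (sym_mx v) == 1%N);
      npoints U (fun v => v \in nucleus_plane F);
      npoints U (fun v => (\rank (sym_mx v) == 2%N) && (v \notin nucleus_plane F));
      npoints U (fun v => \rank (sym_mx v) == 3%N)].
Proof.
have pN P : P \in points U -> (P \in points (nucleus_plane F)) = (vpick P \in nucleus_plane F).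
  rewrite inE => /andP[/eqP dP _]; have [p0 eP] := dim1_vpick dP.
  by rewrite {1}eP mem_points_line.
move: pN; rewrite /OD0 /npoints; move: (points U) (points (nucleus_plane F)) => X Y XY.
congr [:: _; _; _; _]; apply: eq_card => P; rewrite !inE //.
  by case: (boolP (P \in X)) => // PX; rewrite XY.
by case: (boolP (P \in X)) => // PX; rewrite XY.
Qed.

Lemma npoints_Kact (A : 'M[F]_3) U (Q : pred 'rV[F]_6) :
    A \in unitmx -> (forall (a : F) v, a != 0 -> Q (a *: v) = Q v) ->
    (forall v, Q (Kmap A v) = Q v) ->
  npoints (Kact A U) Q = npoints U Q.
Proof.
move=> uA QZ QA; have q1 : (0 < #|F|.-1)%N.
  by rewrite -subn1 subn_gt0 finNzRing_gt1.
apply/eqP; rewrite -(eqn_pmul2r q1) !card_points_scale //; apply/eqP.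
rewrite -[RHS](card_imset _ (can_inj (KmapK uA))); apply: eq_card => v.
rewrite inE; apply/and3P/imsetP => [[/memKactP[w wU ->] v0 Qv]|[w]].
  by exists w => //; rewrite inE wU -(Kmap_eq0 w uA) v0 -QA.
by rewrite inE => /and3P[wU w0 Qw ->]; split; rewrite ?memKact ?Kmap_eq0 ?QA.
Qed.

Lemma OD0_Kact (A : 'M[F]_3) U : A \in unitmx -> OD0 (Kact A U) = OD0 U.
Proof.
move=> uA; rewrite !OD0E.
by congr [:: _; _; _; _]; apply: (@npoints_Kact A _ _ uA) => [a v a0|v];
  rewrite ?rank_Kmap ?mem_nucleus_Kmap // ?rank_sym_mxZ ?memvZE.
Qed.

Lemma OD0_Korbit U V : V \in Korbit U -> OD0 V = OD0 U.
Proof. by case/imsetP => A uA ->; apply: OD0_Kact. Qed.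

End Distribution.

Section PlaneDistribution.

Variables (F : finFieldType) (charF2 : 2%N \in [pchar F]).

Lemma det_gvec (c c' b b' x y z : F) :
  \det (sym_mx (gvec c c' b b' x y z)) = x * y ^+ 2 + z * (b * x + b' * z) ^+ 2.
Proof. by rewrite det3E !mxE /= ?mxE /=; ring2 charF2. Qed.

Lemma sym_mx_eq0 (v : 'rV[F]_6) : (sym_mx v == 0) = (v == 0).
Proof.
apply/eqP/eqP => [/(congr1 (@sym_coords F))|->].
  by rewrite sym_mxK => ->; apply: eq_row6; rewrite !mxE /= ?mxE.
by apply/matrixP => -[[|[|[|//]]] i] [[|[|[|//]]] j]; rewrite !mxE /= ?mxE.
Qed.

(** The three principal 2 by 2 minors give y = 0, t = 0 and s^2 = x z, so the matrix would be
    zero. *)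
Lemma rank_gvec_neq1 (c c' b b' x y z : F) :
  no_rank1 c c' b b' -> \rank (sym_mx (gvec c c' b b' x y z)) <> 1%N.
Proof.
move=> nr r1; have m i j k l := rank1_minors i j k l r1.
have := m 1 2 2 1; have := m 0 2 2 0; have := m 0 1 1 0; rewrite !mxE /= ?mxE /=.
move=> e1 e2 /eqP; rewrite mulr0 -expr2 sqrf_eq0 => /eqP y0.
move/eqP: e2; rewrite mulr0 -expr2 sqrf_eq0 => /eqP t0.
have [x0 z0] := nr x z t0 e1; move: r1; rewrite x0 y0 z0 gvec0.
by have /eqP -> : sym_mx (0 : 'rV[F]_6) == 0; rewrite ?sym_mx_eq0 // mxrank0.
Qed.

Lemma gvec_inj c c' b b' :
  injective (fun t : F * F * F => gvec c c' b b' t.1.1 t.1.2 t.2).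
Proof. by move=> [[x y] z] [[x' y'] z'] /gvec_eq[/= -> -> ->]. Qed.

Lemma card_gplane c c' b b' (Q : pred 'rV[F]_6) :
  #|[set v in gplane c c' b b' | Q v]| =
  #|[set t : F * F * F | Q (gvec c c' b b' t.1.1 t.1.2 t.2)]|.
Proof.
rewrite -(card_imset _ (@gvec_inj c c' b b')); apply: eq_card => v.
rewrite inE; apply/andP/imsetP => [[/gplaneP[x [y [z ->]]] Qv]|[[[x y] z]]].
  by exists (x, y, z); rewrite ?inE.
by rewrite inE => Qv ->; rewrite gvec_in.
Qed.

(** The hypothesis counts the zeros of the determinant. Of these, q have x = z = 0 and form the
    nucleus point together with 0; the other n (q - 1) have rank 2, since rank 1 is excluded. The
    nonsingular vectors are the complement. *)
Lemma OD0_gplane c c' b b' n : no_rank1 c c' b b' ->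
    #|[set t : F * F * F |
       t.1.1 * t.1.2 ^+ 2 + t.2 * (b * t.1.1 + b' * t.2) ^+ 2 == 0%R]| =
      (n * #|F|.-1 + #|F|)%N ->
  OD0 (gplane c c' b b') = [:: 0; 1; n; #|F| ^ 2 + #|F| - n]%N.
Proof.
move=> nr; set N := [set t : F * F * F | _] => cN.
pose g (t : F * F * F) := gvec c c' b b' t.1.1 t.1.2 t.2.
pose Z := [set t : F * F * F | (t.1.1 == 0) && (t.2 == 0)].
have cZ : #|Z| = #|F|.
  rewrite -(card_imset _ (f := fun y : F => (0 : F, y, 0 : F))); last by move=> y y' [].
  apply: eq_card => -[[x y] z]; rewrite inE /=; apply/andP/imsetP => [[/eqP-> /eqP->]|].
    by exists y.
  by case=> w _ [-> _ ->].
have Z0 : (0 : F * F * F) \in Z by rewrite inE /= eqxx.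
have ZN : Z \subset N.
  apply/subsetP => -[[x y] z]; rewrite !inE /= => /andP[/eqP-> /eqP->].
  by rewrite !mul0r addr0.
have q2 := finNzRing_gt1 F; have q1 : (0 < #|F|.-1)%N by rewrite -subn1 subn_gt0.
have nucE t : (g t \in nucleus_plane F) = (t \in Z).
  by rewrite mem_nucleus_plane inE !mxE /= eqxx andbT.
have detE t : (\det (sym_mx (g t)) == 0) = (t \in N) by rewrite det_gvec inE.
have gE0 t : (g t == 0) = (t == 0).
  by rewrite -(inj_eq (@gvec_inj c c' b b')) gvec0.
have r1 t : (\rank (sym_mx (g t)) == 1%N) = false.
  by apply/eqP; apply: rank_gvec_neq1.
have r3 t : (\rank (sym_mx (g t)) == 3%N) = (t \notin N) by rewrite rank3_det detE.
have r2 t : (\rank (sym_mx (g t)) == 2%N) = (t \in N) && (t != 0).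
  have := mxrank_eq0 (sym_mx (g t)); rewrite sym_mx_eq0 gE0 => <-.
  have := r1 t; have := r3 t; have := rank_leq_row (sym_mx (g t)).
  by case: (\rank _) => [|[|[|[|k]]]] //= _; case: (t \in N).
have count (Q : pred 'rV[F]_6) (m : nat) : (forall (a : F) v, a != 0 -> Q (a *: v) = Q v) ->
    #|[set t : F * F * F | (t != 0) && Q (g t)]| = (m * #|F|.-1)%N ->
    npoints (gplane c c' b b') Q = m.
  move=> QZ cQ; apply/eqP; rewrite -(eqn_pmul2r q1) card_points_scale // -cQ.
  rewrite card_gplane; apply/eqP/eq_card => t; by rewrite !inE -gE0.
rewrite OD0E; congr [:: _; _; _; _]; apply: count.
- by move=> a v a0; rewrite rank_sym_mxZ.
- by apply: eq_card0 => t; rewrite inE r1 andbF.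
- by move=> a v a0; rewrite memvZE.
- rewrite mul1n -cZ (cardsD1 (0 : F * F * F) Z) Z0 add1n.
  by apply: eq_card => t; rewrite !inE nucE inE.
- by move=> a v a0; rewrite rank_sym_mxZ // memvZE.
- transitivity #|N :\: Z|; last by rewrite cardsD (setIidPr ZN) cN cZ addnK.
  apply: eq_card => t; rewrite in_set in_setD r2 nucE.
  case: eqVneq => [->|_]; first by rewrite Z0 andbF.
  by rewrite /= andbT andbC.
- by move=> a v a0; rewrite rank_sym_mxZ.
transitivity #|~: N|.
  apply: eq_card => t; rewrite in_set in_setC r3.
  by case: eqVneq => [->|//]; rewrite (subsetP ZN).
(* This is q^3 - q = (q^2 + q)(q - 1), from which n (q - 1) is subtracted on both sides; truncated
   subtraction distributes over the product. *)
rewrite cardsCs setCK !card_prod cN addnC subnDA mulnBl.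
case: #|F| q1 => [//|k] _ /=; congr (_ - _)%N.
by rewrite -[RHS](addnK k.+1); congr (_ - _)%N; ring.
Qed.

(* A zero of the cubic with x <> 0 is (x, g x w) for a unique w. *)
Lemma card_cubic_plane (D : pred (F * F * F)) (g : F -> F -> F * F) :
    (forall y z, D (0, y, z)) -> (forall x, injective (g x)) ->
    (forall x y z, x != 0 ->
       reflect (exists w, g x w = (y, z)) (D (x, y, z))) ->
  #|[set t | D t]| = (2 * #|F| * #|F|.-1 + #|F|)%N.
Proof.
move=> D0 ginj Dg; rewrite -(cardsID [set t : F * F * F | t.1.1 == 0]).
have -> : #|[set t | D t] :&: [set t : F * F * F | t.1.1 == 0]| = (#|F| * #|F|)%N.
  rewrite -card_prod -(card_imset _ (f := fun p : F * F => (0 : F, p.1, p.2))); last first.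
    by move=> [y z] [y' z'] [/= -> ->].
  apply: eq_card => -[[x y] z]; rewrite !inE /=; apply/andP/imsetP => [[_ /eqP->]|].
    by exists (y, z).
  by case=> -[y' z'] _ [-> -> ->]; rewrite D0.
have -> : #|[set t | D t] :\: [set t : F * F * F | t.1.1 == 0]| = (#|F|.-1 * #|F|)%N.
  have -> : (#|F|.-1 * #|F|)%N = #|setX [set~ (0 : F)] [set: F]|.
    by rewrite cardsX cardsC1 cardsT.
  rewrite -(card_imset _ (f := fun p : F * F => (p.1, (g p.1 p.2).1, (g p.1 p.2).2))); last first.
    move=> [x w] [x' w'] /= [<-] h1 h2; congr (_, _); apply: (ginj x).
    by rewrite [g x w]surjective_pairing h1 h2 -surjective_pairing.
  apply: eq_card => -[[x y] z]; rewrite !inE /=; apply/andP/imsetP => [[x0]|].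
    by case/(Dg _ _ _ x0) => w e; exists (x, w); rewrite /= ?e // !inE x0.
  case=> -[x' w]; rewrite !inE andbT /= => x0 [-> -> ->]; split=> //.
  by apply/(Dg _ _ _ x0); exists w; rewrite -surjective_pairing.
have q2 := finNzRing_gt1 F.
by case: #|F| q2 => [//|k] _ /=; ring.
Qed.

Lemma OD0_rep21 (a : F) : trace2 a = 1 ->
  OD0 (rep21 a) = [:: 0; 1; 2 * #|F|; #|F| ^ 2 - #|F|]%N.
Proof.
move=> ta; rewrite -gplane_rep21.
rewrite (OD0_gplane (n := 2 * #|F|) (no_rank1_rep21 charF2 ta)).
  by rewrite mul2n -addnn subnDr.
(* The cubic is x y^2: off the plane x = 0 its zeros have y = 0 and z free. *)
apply: (@card_cubic_plane _ (fun x w => (0, w))) => [y z|x w w' []|x y z x0] //=.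
  by apply/eqP; ring.
apply: (iffP eqP) => [/eqP|[w [<- _]]]; last by ring.
rewrite !mul0r addr0 expr0n mulr0 addr0 mulf_eq0 (negPf x0) sqrf_eq0 => /eqP->.
by exists z.
Qed.

Lemma OD0_rep23 (a : F) : a != 0 ->
  OD0 (rep23 a) = [:: 0; 1; 2 * #|F|; #|F| ^ 2 - #|F|]%N.
Proof.
move=> a0; rewrite -gplane_rep23.
rewrite (OD0_gplane (n := 2 * #|F|) (no_rank1_rep23 a0)).
  by rewrite mul2n -addnn subnDr.
(* The cubic is x (y^2 + x z): off the plane x = 0 its zeros have y free and z = y^2 / x. *)
apply: (@card_cubic_plane _ (fun x w => (w, w ^+ 2 / x))) => [y z|x w w' []|x y z x0] //=.
  by apply/eqP; ring.
apply: (iffP eqP) => [e|[w [<- <-]]]; last by field2 charF2.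
exists y; congr (_, _); apply: (addr_eq0_pchar2 charF2).
transitivity ((x * y ^+ 2 + z * (1 * x + 0 * z) ^+ 2) / x ^+ 2); last by rewrite e mul0r.
by field.
Qed.

Lemma OD0_rep22 : OD0 (rep22 F) = [:: 0; 1; #|F|; #|F| ^ 2]%N.
Proof.
rewrite -gplane_rep22 (OD0_gplane (n := #|F|) (@no_rank1_rep22 F)); first by rewrite addnK.
transitivity (#|F| * #|F|)%N; last first.
  by have q2 := finNzRing_gt1 F; case: #|F| q2 => [//|k] _ /=; ring.
(* The cuspidal cubic x y^2 + z^3 is parametrised by (y, z) with x = z^3 / y^2 when y is nonzero. If
   y = 0 then z = 0, and the second parameter serves as the free x. *)
pose f (p : F * F) := if p.1 == 0 then (p.2, 0, 0) else (p.2 ^+ 3 / p.1 ^+ 2, p.1, p.2).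
rewrite -card_prod -(card_imset _ (f := f)); last first.
  move=> [y z] [y' z']; rewrite /f /=; case: eqVneq => [->|y0]; case: eqVneq => [->|y'0].
  - by case=> ->.
  - by case=> _ e; rewrite -e eqxx in y'0.
  - by case=> _ e; rewrite e eqxx in y0.
  - by case=> _ -> ->.
apply: eq_card => -[[x y] z]; rewrite !inE /=; apply/eqP/imsetP => [e|[[u w] _]].
  have [y0|y0] := eqVneq y 0.
    have z0 : z = 0.
      apply/eqP; move/eqP: e; rewrite y0 expr0n mulr0 add0r mul0r mul1r add0r.
      by rewrite mulf_eq0 sqrf_eq0 orbb.
    by exists (0, x); rewrite // /f /= eqxx y0 z0.
  exists (y, z); rewrite // /f /= (negPf y0); congr (_, _, _).
  apply: (addr_eq0_pchar2 charF2).
  transitivity ((x * y ^+ 2 + z * (0 * x + 1 * z) ^+ 2) / y ^+ 2); first by field.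
  by rewrite e mul0r.
by rewrite /f /=; case: eqVneq => [_|u0] [-> -> ->]; [ring | field2 charF2].
Qed.

End PlaneDistribution.

(** * Nuclei and the hyperplanes H(P), H(pi) *)

Section DimensionTwo.

Variables (F : fieldType) (vT : vectType F).
Implicit Types (u v w : vT) (U : {vspace vT}).

Definition independent2 u w := forall a b : F, a *: u + b *: w = 0 -> a = 0 /\ b = 0.

Lemma independent2_neq0 u w : independent2 u w -> u != 0 /\ w != 0.
Proof.
move=> ind; split; apply/eqP => z0; [have [|/eqP] := ind 1 0|have [|_ /eqP] := ind 0 1];
  by rewrite ?z0 ?scaler0 ?scale0r ?addr0 ?oner_eq0.
Qed.

Lemma dim_add_lines u w : independent2 u w -> \dim (<[u]> + <[w]>) = 2%N.
Proof.
move=> ind; have [u0 w0] := independent2_neq0 ind.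
rewrite dimv_disjoint_sum ?dim_vline ?u0 ?w0 //; apply/eqP; rewrite -subv0.
apply/subvP => x /memv_capP[/vlineP[a ->] /vlineP[b e]].
have [|-> _] := ind a (- b); first by rewrite e scaleNr subrr.
by rewrite scale0r mem0v.
Qed.

Lemma dim2_basis_from U u : \dim U = 2%N -> u \in U -> u != 0 ->
  exists w, [/\ w \in U, independent2 u w &
                forall x, x \in U -> exists a b, x = a *: u + b *: w].
Proof.
move=> dU uU u0; have [w wU wu] : exists2 w, w \in U & w \notin <[u]>%VS.
  have /subvPn[w wU wu] : ~~ (U <= <[u]>)%VS.
    by apply/negP => /dimvS; rewrite dU dim_vline u0.
  by exists w.
have ind : independent2 u w.
  move=> a b e; have b0 : b = 0.
    apply/eqP; apply: contraNT wu => b0; apply/vlineP; exists (- (a / b)).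
    apply: (scalerI b0); rewrite scalerA mulrN mulrCA divff // mulr1 scaleNr.
    by apply/eqP; rewrite -addr_eq0 addrC e.
  split=> //; move/eqP: e; rewrite b0 scale0r addr0 scaler_eq0 (negPf u0) orbF.
  by move/eqP.
exists w; split=> // x; have -> : U = (<[u]> + <[w]>)%VS.
  by apply/eqP; rewrite eq_sym eqEdim dU dim_add_lines // subv_add -!memvE uU wU.
by case/memv_addP => _ /vlineP[a ->] [_ /vlineP[b ->] ->]; exists a, b.
Qed.

End DimensionTwo.

Lemma collinear_row (F : fieldType) n (l m : 'rV[F]_n) :
  m != 0 -> (forall i j, l 0 i * m 0 j = l 0 j * m 0 i) -> exists k, l = k *: m.
Proof.
move=> m0 lm; have [j mj] : exists j, m 0 j != 0.
  apply/existsP; apply: contraNT m0 => /existsPn h; apply/eqP/rowP => j.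
  by rewrite mxE; apply/eqP/negPn/h.
exists (l 0 j / m 0 j); apply/rowP => i; rewrite mxE.
by apply: (mulIf mj); rewrite lm mulrAC divfK.
Qed.

Section Nucleus.

Variables (F : finFieldType) (charF2 : 2%N \in [pchar F]).
Implicit Types (u w l m : 'rV[F]_3) (v : 'rV[F]_6).

(** The cross product with signs dropped, as is right in characteristic 2. *)
Definition cross u w : 'rV[F]_3 :=
  \row_(i < 3) [:: u 0 1 * w 0 2 + u 0 2 * w 0 1; u 0 0 * w 0 2 + u 0 2 * w 0 0;
                   u 0 0 * w 0 1 + u 0 1 * w 0 0]`_i.

(* The alternating matrix with kernel m. *)
Definition alt_vec m : 'rV[F]_6 := row6 0 (m 0 2) (m 0 1) 0 (m 0 0) 0.

Lemma collinear3 l m :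
  m != 0 -> cross l m = 0 -> exists k, l = k *: m.
Proof.
move=> m0 /rowP h; apply: collinear_row => //.
have [e0 e1 e2] : [/\ l 0 1 * m 0 2 = l 0 2 * m 0 1, l 0 0 * m 0 2 = l 0 2 * m 0 0 &
                      l 0 0 * m 0 1 = l 0 1 * m 0 0].
  by split; apply: (addr_eq0_pchar2 charF2); [have := h 0 | have := h 1 | have := h 2];
    rewrite !mxE.
have ord3 (i : 'I_3) : [\/ i = 0, i = 1 | i = 2].
  by case: i => [[|[|[|//]]] i]; [constructor 1|constructor 2|constructor 3]; apply: val_inj.
by move=> i j; case: (ord3 i) => ->; case: (ord3 j) => ->.
Qed.

Lemma alt_vecZ (k : F) m : alt_vec (k *: m) = k *: alt_vec m.
Proof. by apply: eq_row6; rewrite !mxE /= ?mulr0. Qed.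

Lemma alt_vec_eq0 m : (alt_vec m == 0) = (m == 0).
Proof.
apply/eqP/eqP => [/rowP h|->]; last by apply: eq_row6; rewrite !mxE.
by apply: eq_row3; rewrite mxE; [have := h 4|have := h 2|have := h 1]; rewrite !mxE.
Qed.

Lemma alt_vec_inj : injective alt_vec.
Proof.
move=> m m' /rowP h.
by apply: eq_row3; [have := h 4|have := h 2|have := h 1]; rewrite !mxE.
Qed.

Lemma nucleus_alt_vec v : v \in nucleus_plane F -> exists m, v = alt_vec m.
Proof.
rewrite mem_nucleus_plane => /and3P[/eqP h0 /eqP h3 /eqP h5].
exists (\row_(i < 3) [:: v 0 4; v 0 2; v 0 1]`_i).
by apply: eq_row6; rewrite !mxE.
Qed.

(** The mixed term is u w^T + w u^T, alternating with kernel u x w. In this frame the conic of the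
    line through u and w is (a^2, b^2, a b), and in characteristic 2 the third frame point is its
    nucleus. *)
Lemma veronese_comb (a b : F) u w :
  veronese (a *: u + b *: w) =
  a ^+ 2 *: veronese u + b ^+ 2 *: veronese w + (a * b) *: alt_vec (cross u w).
Proof. by apply: eq_row6; rewrite !mxE /=; ring2 charF2. Qed.

Lemma cross_neq0 u w : independent2 u w -> cross u w != 0.
Proof.
move=> ind; have [_ w0] := independent2_neq0 ind.
apply/eqP => /(collinear3 w0)[k e]; have [|/eqP] := ind 1 (- k); last by rewrite oner_eq0.
by rewrite scale1r scaleNr -e subrr.
Qed.

(* On the diagonal the relation reads a u_i^2 + b w_i^2 = 0, and its square root
   is a linear relation between u and w. *)
Lemma veronese_independent (a b c : F) u w : independent2 u w ->
  a *: veronese u + b *: veronese w + c *: alt_vec (cross u w) = 0 ->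
  [/\ a = 0, b = 0 & c = 0].
Proof.
move=> ind e; have [a' ea] := sqrt_pchar2 charF2 a; have [b' eb] := sqrt_pchar2 charF2 b.
have [a0 b0] : a' = 0 /\ b' = 0.
  apply: ind; move/rowP: e => e.
  apply: eq_row3; apply: (sqr_inj_pchar2 charF2); [have := e 0|have := e 3|have := e 5];
  rewrite !mxE /= mulr0 addr0 -ea -eb -!exprMn -sqrD_pchar2 // => ->; ring.
move: e; rewrite -ea -eb a0 b0 expr0n !scale0r !add0r => /eqP.
rewrite scaler_eq0 alt_vec_eq0 (negPf (cross_neq0 ind)) orbF => /eqP->.
by split.
Qed.

Lemma mem_double_line l v : (v \in hyperplane (double_line l)) =
  (l 0 0 ^+ 2 * v 0 0 + l 0 1 ^+ 2 * v 0 3 + l 0 2 ^+ 2 * v 0 5 == 0).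
Proof.
rewrite mem_hyperplane !mxE /=; congr (_ == _).
by ring2 charF2.
Qed.

Lemma veronese_double_line l u : (veronese u \in hyperplane (double_line l)) =
  (l 0 0 * u 0 0 + l 0 1 * u 0 1 + l 0 2 * u 0 2 == 0).
Proof.
rewrite mem_double_line -[RHS]sqrf_eq0 !mxE /=; congr (_ == _); ring2 charF2.
Qed.

Definition perp m : {vspace 'rV[F]_3} :=
  lker (linfun (mulmxr m^T : 'rV[F]_3 -> 'M[F]_1)).

Lemma mem_perp m u :
  (u \in perp m) = (u 0 0 * m 0 0 + u 0 1 * m 0 1 + u 0 2 * m 0 2 == 0).
Proof.
have -> : (u \in perp m) = ((u *m m^T) 0 0 == 0).
  rewrite memv_ker lfunE /=; apply/eqP/eqP => [->|h]; first by rewrite mxE.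
  by apply/matrixP => i j; rewrite !ord1 h mxE.
by rewrite mxE sum3E !mxE.
Qed.

Lemma dim_perp m : m != 0 -> \dim (perp m) = 2%N.
Proof.
move=> m0; set f := linfun (mulmxr m^T : 'rV[F]_3 -> 'M[F]_1).
have := limg_ker_dim f fullv; rewrite capfv dimvf /dim /=.
suff -> : \dim (limg f) = 1%N by rewrite mul1n addn1 => -[].
apply/eqP; rewrite eqn_leq; apply/andP; split.
  by apply: leq_trans (dimvS (subvf _)) _; rewrite dimvf.
rewrite lt0n dimv_eq0; apply: contra m0 => /eqP h.
apply/eqP/rowP => j; rewrite mxE.
have : f (delta_mx 0 j) \in limg f by rewrite memv_img ?memvf.
rewrite h memv0 lfunE /= => /eqP/matrixP/(_ 0 0).
by rewrite -rowE !mxE.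
Qed.

(** The triple product (u x w) x m equals (u.m) w + (w.m) u up to sign, and both dot products
    vanish. *)
Lemma cross_perp m u w : m != 0 -> u \in perp m -> w \in perp m ->
  exists k, cross u w = k *: m.
Proof.
move=> m0; rewrite !mem_perp => /eqP hu /eqP hw; apply: collinear3 => //.
apply: eq_row3; rewrite !mxE /=.
- transitivity (w 0 0 * (u 0 0 * m 0 0 + u 0 1 * m 0 1 + u 0 2 * m 0 2) +
    u 0 0 * (w 0 0 * m 0 0 + w 0 1 * m 0 1 + w 0 2 * m 0 2)); first by ring2 charF2.
  by rewrite hu hw; ring.
- transitivity (w 0 1 * (u 0 0 * m 0 0 + u 0 1 * m 0 1 + u 0 2 * m 0 2) +
    u 0 1 * (w 0 0 * m 0 0 + w 0 1 * m 0 1 + w 0 2 * m 0 2)); first by ring2 charF2.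
  by rewrite hu hw; ring.
- transitivity (w 0 2 * (u 0 0 * m 0 0 + u 0 1 * m 0 1 + u 0 2 * m 0 2) +
    u 0 2 * (w 0 0 * m 0 0 + w 0 1 * m 0 1 + w 0 2 * m 0 2)); first by ring2 charF2.
  by rewrite hu hw; ring.
Qed.

End Nucleus.

(** * Tangents and nuclei of conics, and the hyperplanes H(P) and H(pi) *)

Section HyperplaneOfPoint.

Variables (F : finFieldType) (charF2 : 2%N \in [pchar F]).
Implicit Types (u w l m : 'rV[F]_3) (v : 'rV[F]_6) (L : {vspace 'rV[F]_3}).

Lemma hyperplane_double_lineZ (k : F) l : k != 0 ->
  hyperplane (double_line (k *: l)) = hyperplane (double_line l).
Proof.
move=> k0; apply/vspaceP => v; rewrite !mem_double_line //.
rewrite -[in RHS](inj_eq (mulfI (expf_neq0 2 k0))) mulr0 !mxE.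
by congr (_ == 0); ring.
Qed.

Definition conic L : {set {vspace 'rV[F]_6}} := [set veronese_point P | P in points L].

Lemma mem_conic L Q : reflect (exists u, [/\ u != 0, u \in L & Q = <[veronese u]>%VS])
  (Q \in conic L).
Proof.
apply: (iffP imsetP) => [[P /mem_pointsP[u [u0 uL ->]] ->]|[u [u0 uL ->]]].
  by exists u; rewrite veronese_line.
by exists <[u]>%VS; rewrite ?mem_points_line ?veronese_line.
Qed.

Lemma veronese_in_span L u : u \in L -> veronese u \in (\sum_(P in conic L) P)%VS.
Proof.
move=> uL; have [->|u0] := eqVneq u 0.
  by have /eqP -> : veronese (0 : 'rV[F]_3) == 0; rewrite ?veronese_eq0 // mem0v.
have Cu : <[veronese u]>%VS \in conic L by apply/mem_conic; exists u.
by apply: (subvP (sumv_sup _ Cu (subvv _))); apply: memv_line.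
Qed.

Lemma conic_span L u w v : (forall x, x \in L -> exists a b, x = a *: u + b *: w) ->
    v \in (\sum_(P in conic L) P)%VS ->
  exists a b c, v = a *: veronese u + b *: veronese w + c *: alt_vec (cross u w).
Proof.
move=> gen; suff sC : (\sum_(P in conic L) P <=
    <[veronese u]> + <[veronese w]> + <[alt_vec (cross u w)]>)%VS.
  move/(subvP sC)/memv_addP => [_ /memv_addP[_ /vlineP[a ->] [_ /vlineP[b ->] ->]]].
  by case=> _ /vlineP[c ->] ->; exists a, b, c.
apply/subv_sumP => _ /mem_conic[x [_ /gen[a [b ->]] ->]].
by rewrite -memvE veronese_comb // !memv_add ?memvZ ?memv_line.
Qed.

(** A conic point (a^2, b^2, a b) on the line through the first and third frame points has b^2 = 0,
    so it is [veronese u]. *)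
Lemma tangent_conic L u w : u \in L -> w \in L -> independent2 u w ->
    (forall x, x \in L -> exists a b, x = a *: u + b *: w) ->
  tangent_line (conic L) (<[veronese u]> + <[alt_vec (cross u w)]>)%VS.
Proof.
move=> uL wL ind gen; have [u0 _] := independent2_neq0 ind.
apply/and3P; split.
- rewrite dim_add_lines // => a b e.
  have [|-> _ ->] := @veronese_independent F charF2 a 0 b u w ind => //.
  by rewrite scale0r addr0.
- rewrite subv_add -!memvE veronese_in_span //=.
  have -> : alt_vec (cross u w) = veronese (1 *: u + 1 *: w) - veronese u - veronese w.
    rewrite veronese_comb //; move: (veronese u) (veronese w) (alt_vec _) => U W N.
    by apply/rowP => i; rewrite !mxE; ring.
  by rewrite !rpredB ?veronese_in_span // !scale1r memvD.
apply/cards1P; exists <[veronese u]>%VS; apply/setP => Q.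
rewrite in_setI in_set1; apply/andP/eqP => [[QT /mem_conic[x [x0 /gen[a [b ex]] eQ]]]|->].
  move: QT; rewrite eQ mem_points_line ?veronese_eq0 // => /memv_addP[_ /vlineP[a' ->]].
  case=> _ /vlineP[b' ->]; rewrite ex veronese_comb // => /eqP; rewrite -subr_eq0 => /eqP e.
  have b0 : b = 0.
    have [|_ /eqP] := @veronese_independent F charF2 (a ^+ 2 - a') (b ^+ 2) (a * b - b') u w ind.
      rewrite -[RHS]e; move: (veronese u) (veronese w) (alt_vec _) => U W N.
      by apply/rowP => i; rewrite !mxE; ring.
    by rewrite sqrf_eq0 => /eqP.
  have a0 : a != 0 by apply: contraNneq x0 => a0; rewrite ex a0 b0 !scale0r addr0.
  rewrite b0 mulr0 expr0n !scale0r !addr0.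
  by rewrite vline_scale ?expf_neq0.
split; last by apply/mem_conic; exists u.
rewrite mem_points_line ?veronese_eq0 //.
by apply: (subvP (addvSl _ _)); apply: memv_line.
Qed.

Lemma alt_vec_in_tangent m (T : {vspace 'rV[F]_6}) :
  m != 0 -> tangent_line (conic (perp m)) T -> alt_vec m \in T.
Proof.
move=> m0 /and3P[/eqP dT sT /cards1P[Q eQ]].
have : Q \in points T :&: conic (perp m) by rewrite eQ set11.
rewrite in_setI => /andP[QT /mem_conic[u [u0 uL eu]]].
have uT : veronese u \in T by move: QT; rewrite eu mem_points_line ?veronese_eq0.
have [w [wL ind gen]] := dim2_basis_from (dim_perp m0) uL u0.
have vu0 : veronese u != 0 by rewrite veronese_eq0.
have [v [vT indT _]] := dim2_basis_from dT uT vu0.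
have [k ek] := cross_perp charF2 m0 uL wL.
have k0 : k != 0.
  by apply: contraNneq (cross_neq0 charF2 ind) => k0; rewrite ek k0 scale0r.
suff : alt_vec (cross u w) \in T by rewrite ek alt_vecZ memvZE.
have [a [b [c ev]]] := conic_span gen (subvP sT _ vT).
have [b0|b0] := eqVneq b 0.
  have c0 : c != 0.
    apply/eqP => c0; have [|_ /eqP] := indT (- a) 1; last by rewrite oner_eq0.
    by rewrite ev b0 c0 !scale0r !addr0 scale1r scaleNr addNr.
  rewrite -(memvZE _ _ c0).
  have -> : c *: alt_vec (cross u w) = v - a *: veronese u.
    by rewrite ev b0 scale0r addr0 addrC addKr.
  by rewrite rpredB ?memvZ.
(* If b were nonzero, T would pass through this second point of the conic: its frame coordinates are
   ((c/b)^2, 1, c/b), which differ from those of v / b only in the first place. *)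
pose x := (c / b) *: u + 1 *: w.
have xT : veronese x \in T.
  have -> : veronese x = b^-1 *: v + ((c / b) ^+ 2 - a / b) *: veronese u.
    rewrite /x veronese_comb // ev; move: (veronese u) (veronese w) (alt_vec _) => U W N.
    by apply/rowP => i; rewrite !mxE; field.
  by rewrite memvD ?memvZ.
have x0 : x != 0.
  by apply/eqP => /ind[_ /eqP]; rewrite oner_eq0.
have : <[veronese x]>%VS \in points T :&: conic (perp m).
  rewrite in_setI mem_points_line ?veronese_eq0 // xT.
  by apply/mem_conic; exists x; rewrite memvD ?memvZ.
rewrite eQ in_set1 eu => /eqP e.
have /vlineP[d ed] : veronese x \in <[veronese u]>%VS by rewrite -e memv_line.
have [|_ /eqP] := @veronese_independent F charF2 ((c / b) ^+ 2 - d) 1 (c / b) u w ind.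
  move/eqP: ed; rewrite -subr_eq0 /x veronese_comb // expr1n mulr1 => /eqP <-.
  move: (veronese u) (veronese w) (alt_vec _) => U W N.
  by apply/rowP => i; rewrite !mxE; ring.
by rewrite oner_eq0.
Qed.

(** The [pick] is determined: for a conic with this nucleus, one tangent already forces m to be a
    multiple of u x w, where u and w span its line, so that line is [perp m]. [alt_vec_in_tangent]
    excludes the default. *)
Lemma conic_of_alt_vec m : m != 0 -> conic_of <[alt_vec m]>%VS = conic (perp m).
Proof.
move=> m0; have am0 : alt_vec m != 0 by rewrite alt_vec_eq0.
rewrite /conic_of; case: pickP => [C /andP[/imsetP[L]]|].
  rewrite inE => /eqP dL -> /andP[_ /forall_inP nuc] /=; rewrite -/(conic L).
  have L0 : vpick L != 0 by rewrite vpick0 -dimv_eq0 dL.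
  have [w [wL ind gen]] := dim2_basis_from dL (memv_pick L) L0.
  move: (vpick L) (memv_pick L) ind gen => u uL ind gen.
  have := nuc _ (tangent_conic uL wL ind gen); rewrite -memvE.
  case/memv_addP => _ /vlineP[a ->] [_ /vlineP[b ->] e].
  (* An alternating matrix has zero diagonal, so a u_i^2 = 0 for every i. *)
  have a0 : a = 0.
    have [a' ea] := sqrt_pchar2 charF2 a.
    have /eqP : a' *: u = 0.
      move/rowP: e => e; apply: eq_row3; apply: (sqr_inj_pchar2 charF2);
        [have := e 0|have := e 3|have := e 5];
        rewrite !mxE /= mulr0 addr0 -ea -exprMn => <-; ring.
    have /negPf u0 : u != 0.
      by have [] := independent2_neq0 ind.
    by rewrite scaler_eq0 u0 orbF -ea => /eqP->; rewrite expr0n.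
  move: e; rewrite a0 scale0r add0r -alt_vecZ => /alt_vec_inj em.
  congr conic; apply/eqP; rewrite eqEdim dL dim_perp // andbT; apply/subvP => x /gen[c [d ->]].
  by rewrite memvD // memvZ // mem_perp em !mxE /=; apply/eqP; ring2 charF2.
move/(_ (conic (perp m)))/negP; case; apply/andP; split.
  by apply/imsetP; exists (perp m); rewrite // inE dim_perp.
rewrite /is_nucleus dim_vline am0; apply/forall_inP => T tT.
by rewrite -memvE alt_vec_in_tangent.
Qed.

Lemma H_of_alt_vec m :
  m != 0 -> H_of_point <[alt_vec m]>%VS = hyperplane (double_line m).
Proof.
move=> m0; rewrite /H_of_point conic_of_alt_vec //; case: pickP => [H /andP[/imsetP[l]]|].
  rewrite !inE => l0 -> /subsetP sC /=.
  have orth u : u \in perp m -> l 0 0 * u 0 0 + l 0 1 * u 0 1 + l 0 2 * u 0 2 = 0.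
    move=> uL; have [->|u0] := eqVneq u 0; first by rewrite !mxE !mulr0 !addr0.
    apply/eqP; rewrite -(veronese_double_line charF2) -mem_points_line ?veronese_eq0 //.
    by apply: sC; apply/mem_conic; exists u.
  have [k ek] : exists k, l = k *: m.
    (* The vectors (0, m_2, m_1), (m_2, 0, m_0) and (m_1, m_0, 0) lie in [perp m]; orthogonality of
       l to them says that the three coordinates of l x m vanish. *)
    apply: (collinear3 charF2) => //; apply: eq_row3; rewrite !mxE /=.
    - transitivity (l 0 0 * 0 + l 0 1 * m 0 2 + l 0 2 * m 0 1); first by ring.
      have := orth (\row_(i < 3) [:: 0; m 0 2; m 0 1]`_i).
      by rewrite mem_perp !mxE /= => ->; rewrite ?mul0r ?add0r // mulrC (addrr_pchar2 charF2).
    - transitivity (l 0 0 * m 0 2 + l 0 1 * 0 + l 0 2 * m 0 0); first by ring.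
      have := orth (\row_(i < 3) [:: m 0 2; 0; m 0 0]`_i).
      by rewrite mem_perp !mxE /= => ->; rewrite ?mul0r ?addr0 // mulrC (addrr_pchar2 charF2).
    - transitivity (l 0 0 * m 0 1 + l 0 1 * m 0 0 + l 0 2 * 0); first by ring.
      have := orth (\row_(i < 3) [:: m 0 1; m 0 0; 0]`_i).
      by rewrite mem_perp !mxE /= => ->; rewrite ?mul0r ?addr0 // mulrC (addrr_pchar2 charF2).
  rewrite ek hyperplane_double_lineZ //.
  by apply: contraNneq l0 => k0; rewrite ek k0 scale0r.
move/(_ (hyperplane (double_line m)))/negP; case; apply/andP; split.
  by apply/imsetP; exists m; rewrite ?inE.
apply/subsetP => _ /mem_conic[u [u0 uL ->]].
rewrite mem_points_line ?veronese_eq0 // veronese_double_line //.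
by move: uL; rewrite mem_perp ![_ * m _ _]mulrC.
Qed.

Lemma H_of_plane_double_line (U : {vspace 'rV[F]_6}) l :
    l != 0 -> (U <= hyperplane (double_line l))%VS ->
    (forall l', l' != 0 -> (U <= hyperplane (double_line l'))%VS ->
      exists k, l' = k *: l) ->
  H_of_plane U = hyperplane (double_line l).
Proof.
move=> l0 Ul uniq; rewrite /H_of_plane; case: pickP => [H /andP[/imsetP[l']]|].
  rewrite !inE => l'0 -> Ul' /=; have [k ek] := uniq _ l'0 Ul'.
  rewrite ek hyperplane_double_lineZ //.
  by apply: contraNneq l'0 => k0; rewrite ek k0 scale0r.
move/(_ (hyperplane (double_line l)))/negP; case; rewrite Ul andbT.
by apply/imsetP; exists l; rewrite ?inE.
Qed.

End HyperplaneOfPoint.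

(** * Reduction to the normal form *)

Section Normalisation.

Variables (F : finFieldType) (charF2 : 2%N \in [pchar F]).
Implicit Types (u w l m : 'rV[F]_3) (v : 'rV[F]_6) (U : {vspace 'rV[F]_6}).

Definition row3 (x y z : F) : 'rV[F]_3 := \row_(i < 3) [:: x; y; z]`_i.

Definition diag v : 'rV[F]_3 := row3 (v 0 0) (v 0 3) (v 0 5).

Fact diag_is_linear : linear diag.
Proof. by move=> a v v'; apply: eq_row3; rewrite !mxE. Qed.

HB.instance Definition _ :=
  GRing.isLinear.Build F 'rV[F]_6 'rV[F]_3 _ diag diag_is_linear.

Lemma diag_eq0 v : (diag v == 0) = (v \in nucleus_plane F).
Proof.
rewrite mem_nucleus_plane; apply/eqP/and3P => [/rowP h|[/eqP h0 /eqP h3 /eqP h5]].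
  by split; apply/eqP; [have := h 0 | have := h 1 | have := h 2]; rewrite !mxE.
by apply: eq_row3; rewrite !mxE.
Qed.

(** The kernel of [diag] is the nucleus plane, which meets U only in the point of p; rank-nullity
    leaves 3 - 1. *)
Lemma dim_diag U p :
    \dim U = 3%N -> p != 0 -> p \in U -> p \in nucleus_plane F ->
    (forall v, v \in U -> v \in nucleus_plane F -> v \in <[p]>%VS) ->
  \dim (linfun diag @: U) = 2%N.
Proof.
move=> dU p0 pU pN UN; have := limg_ker_dim (linfun diag) U; rewrite dU.
have -> : (U :&: lker (linfun diag))%VS = <[p]>%VS.
  apply/eqP; rewrite eqEsubv -memvE memv_cap pU memv_ker lfunE /= diag_eq0 pN andbT.
  by apply/subvP => v; rewrite memv_cap memv_ker lfunE /= diag_eq0 => /andP[]; apply: UN.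
by rewrite dim_vline p0 => -[].
Qed.

Lemma Kmap_veronese (A : 'M[F]_3) u : Kmap A (veronese u) = veronese (u *m A^T).
Proof.
by rewrite Kmap_coordsE; apply: eq_row6; rewrite !mxE /= ?(mxE, sum3E) /=; ring.
Qed.

Lemma ex_dot_neq0 u : u != 0 ->
  exists r : 'rV[F]_3, r 0 0 * u 0 0 + r 0 1 * u 0 1 + r 0 2 * u 0 2 != 0.
Proof.
move=> u0; have [e0|n0] := eqVneq (u 0 0) 0; last first.
  by exists (row3 1 0 0); rewrite !mxE /= !mul0r !addr0 mul1r.
have [e1|n1] := eqVneq (u 0 1) 0; last first.
  by exists (row3 0 1 0); rewrite !mxE /= !mul0r addr0 add0r mul1r.
exists (row3 0 0 1); rewrite !mxE /= !mul0r !add0r mul1r.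
by apply: contraNneq u0 => e2; apply/eqP; apply: eq_row3; rewrite mxE.
Qed.

(* A takes the double line l to Y_5 = 0 and the nucleus alt_vec m to a multiple
   of the point Y_4. *)
Lemma frame_matrix m l : cross m l != 0 -> exists A : 'M[F]_3,
  [/\ A \in unitmx, forall k, A 0 k = m 0 k & forall k, A 2 k = l 0 k].
Proof.
(* The middle row r is any vector with r.(m x l) nonzero, because this is the determinant. *)
case/ex_dot_neq0 => r; rewrite !mxE /= => hr.
exists (\matrix_(i < 3, k < 3) [:: m 0 k; r 0 k; l 0 k]`_i).
split; try by move=> k; rewrite mxE.
rewrite unitmxE det3E !mxE /= unitfE; apply: contra_neq hr => d0.
by rewrite -[RHS]d0; ring2 charF2.
Qed.

Lemma row_sqrt n (d : 'rV[F]_n) : exists l : 'rV[F]_n, forall i, l 0 i ^+ 2 = d 0 i.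
Proof.
have [g _ gK] := injF_bij (sqr_inj_pchar2 charF2).
by exists (map_mx g d) => i; rewrite mxE; apply: gK.
Qed.

(** A double line imposes the linear form with coefficients l_i^2 on the diagonals. These form a
    two-dimensional space, which fixes the coefficients up to a scalar as d x d'; bijectivity of
    squaring then yields l, and its uniqueness up to a scalar. *)
Lemma ex_double_line U : \dim (linfun diag @: U) = 2%N -> exists l,
  [/\ l != 0, (U <= hyperplane (double_line l))%VS &
      forall l', l' != 0 -> (U <= hyperplane (double_line l'))%VS -> exists k, l' = k *: l].
Proof.
move=> dD; set D := (linfun diag @: U)%VS in dD *.
have D0 : vpick D != 0 by rewrite vpick0 -dimv_eq0 dD.
have [d' [d'D ind gen]] := dim2_basis_from dD (memv_pick D) D0.
move: (vpick D) (memv_pick D) ind gen => d dD' ind gen.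
have diagU v : v \in U -> exists a b, diag v = a *: d + b *: d'.
  by move=> vU; apply: gen; rewrite -[diag v](lfunE diag) memv_img.
have n0 : cross d d' != 0 := cross_neq0 charF2 ind.
have [l el] := row_sqrt (cross d d').
exists l; split.
- apply: contraNneq n0 => l0; apply/eqP/rowP => i.
  by rewrite -el l0 !mxE expr0n.
- apply/subvP => v /diagU[a [b /rowP e]]; rewrite mem_double_line // !el !mxE /=.
  have := e 0; have := e 1; have := e 2; rewrite !mxE /= => -> -> ->.
  by apply/eqP; ring2 charF2.
move=> l' l'0 Ul'; pose m := \row_(i < 3) l' 0 i ^+ 2.
have m0 : m != 0.
  apply: contraNneq l'0 => /rowP h; apply/eqP/rowP => i; apply/eqP.
  by rewrite mxE -sqrf_eq0; have := h i; rewrite !mxE => ->.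
have Dm x : x \in D -> x \in perp m.
  case/memv_imgP => v /(subvP Ul') vl ->; move: vl.
  by rewrite mem_double_line // mem_perp lfunE /= !mxE /= ![_ * v _ _]mulrC.
have [k ek] := cross_perp charF2 m0 (Dm _ dD') (Dm _ d'D).
have [s es] := sqrt_pchar2 charF2 k.
have s0 : s != 0.
  by apply: contraNneq n0 => s0; rewrite ek -es s0 expr0n scale0r.
exists s^-1; apply: (scalerI s0); rewrite scalerA divff // scale1r.
apply/rowP => i; apply: (sqr_inj_pchar2 charF2); rewrite /= el ek -es !mxE; ring.
Qed.

(** All diagonals (x, z, 0) occur in U. Lifts of (1, 0, 0) and (0, 1, 0) supply the coefficients of
    s and t, and the vector of Y_4 makes y free. *)
Lemma gplane_of_normalised U :
    \dim U = 3%N -> \dim (linfun diag @: U) = 2%N ->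
    (forall v, v \in U -> v 0 5 = 0) -> row6 0 0 0 0 1 0 \in U ->
  exists c c' b b', U = gplane c c' b b'.
Proof.
move=> dU dD U5 eU.
have eD : (linfun diag @: U)%VS = perp (row3 0 0 1).
  apply/eqP; rewrite eqEdim dD dim_perp ?andbT.
    apply/subvP => _ /memv_imgP[v vU ->].
    by rewrite mem_perp lfunE /= !mxE /= U5 // !mulr0 !mul0r !addr0.
  by apply/eqP => /rowP/(_ 2)/eqP; rewrite !mxE /= oner_eq0.
have lift x z : exists2 v, v \in U & v 0 0 = x /\ v 0 3 = z.
  have : row3 x z 0 \in (linfun diag @: U)%VS.
    by rewrite eD mem_perp !mxE /= !mulr0 mul0r !addr0.
  case/memv_imgP => v vU; rewrite lfunE /= => /rowP h; exists v => //.
  by split; [have := h 0 | have := h 1]; rewrite !mxE.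
have [v1 v1U [v10 v13]] := lift 1 0; have [v2 v2U [v20 v23]] := lift 0 1.
exists (v1 0 1), (v2 0 1), (v1 0 2), (v2 0 2).
apply/eqP; rewrite eq_sym eqEdim dim_gplane dU leqnn andbT.
apply/subvP => _ /gplaneP[x [y [z ->]]].
have -> : gvec (v1 0 1) (v2 0 1) (v1 0 2) (v2 0 2) x y z =
    x *: v1 + z *: v2 + (y - x * v1 0 4 - z * v2 0 4) *: row6 0 0 0 0 1 0.
  by apply: eq_row6; rewrite !mxE /= ?v10 ?v13 ?v20 ?v23 ?(U5 v1) ?(U5 v2) //; ring.
by rewrite !memvD ?memvZ.
Qed.

Lemma normal_form U P :
    \dim U = 3%N -> [disjoint points U & veronese_surface F] ->
    points U :&: points (nucleus_plane F) = [set P] ->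
    H_of_point P <> H_of_plane U ->
  exists c c' b b', no_rank1 c c' b b' /\ U \in Korbit (gplane c c' b b').
Proof.
move=> dU dis UN HH.
have : P \in points U :&: points (nucleus_plane F) by rewrite UN set11.
rewrite in_setI => /andP[/mem_pointsP[p [p0 pU eP]]].
rewrite eP mem_points_line // => pN; have [m em] := nucleus_alt_vec pN.
have m0 : m != 0 by rewrite -alt_vec_eq0 -em.
have UNp v : v \in U -> v \in nucleus_plane F -> v \in <[p]>%VS.
  move=> vU vN; have [->|v0] := eqVneq v 0; first exact: mem0v.
  have : <[v]>%VS \in points U :&: points (nucleus_plane F).
    by rewrite in_setI !mem_points_line // vU.
  by rewrite UN in_set1 eP => /eqP <-; apply: memv_line.
have dD := dim_diag dU p0 pU pN UNp.
have [l [l0 Ul luniq]] := ex_double_line dD.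
(* This is where H(P) <> H(pi) enters: proportional m and l define the same double line. *)
have ml : cross m l != 0.
  apply/eqP => /(collinear3 charF2 l0)[k ek]; apply: HH.
  rewrite eP em H_of_alt_vec // (H_of_plane_double_line charF2 l0 Ul luniq).
  rewrite ek hyperplane_double_lineZ //.
  by apply: contraNneq m0 => k0; rewrite ek k0 scale0r.
have [A [uA A0 A2]] := frame_matrix ml.
(* The last row of [A] is l, so the new Y_5 is the sum of the l_k^2 M_kk. *)
have K5 v : v \in Kact A U -> v 0 5 = 0.
  case/memKactP => w /(subvP Ul); rewrite mem_double_line // => /eqP e ->.
  rewrite Kmap_coordsE !mxE /= !A2 -[RHS]e; ring2 charF2.
(* Entry (i, j) of the image is the determinant of m and rows i, j of [A]. Row 0 is m itself, so
   only entry (1, 2) survives. *)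
have Kp : Kmap A p = (Kmap A p) 0 4 *: row6 0 0 0 0 1 0.
  by apply: eq_row6; rewrite em Kmap_coordsE !mxE /= ?A0 ?A2; ring2 charF2.
have Kp0 : (Kmap A p) 0 4 != 0.
  apply: contraNneq p0 => k0; rewrite k0 scale0r in Kp.
  by rewrite -(Kmap_eq0 _ uA) Kp.
have eK : row6 0 0 0 0 1 0 \in Kact A U by rewrite -(memvZE _ _ Kp0) -Kp memKact.
have dK : \dim (Kact A U) = 3%N by rewrite dim_Kact.
have dDK : \dim (linfun diag @: Kact A U) = 2%N.
  apply: (dim_diag dK (p := Kmap A p)).
  - by rewrite Kmap_eq0.
  - exact: memKact.
  - by rewrite mem_nucleus_Kmap.
  move=> _ /memKactP[v vU ->]; rewrite mem_nucleus_Kmap // => /(UNp _ vU)/vlineP[k ->].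
  by rewrite linearZ memvZ ?memv_line.
have [c [c' [b [b' eG]]]] := gplane_of_normalised dK dDK K5 eK.
exists c, c', b, b'; split; last by rewrite -eG Korbit_sym ?Korbit_Kact.
(* A solution (x, z) makes the Veronese vector of (sqrt x, sqrt z, 0) a member of the normalised
   plane; its preimage under [A] would be a point of the surface on the original plane. *)
move=> x z t0 sxz; have [x' ex] := sqrt_pchar2 charF2 x; have [z' ez] := sqrt_pchar2 charF2 z.
suff /rowP u0 : row3 x' z' 0 = 0.
  by have := u0 0; have := u0 1; rewrite !mxE /= -ex -ez => -> ->; rewrite expr0n.
apply/eqP; apply/negPn/negP => u0.
have uK : veronese (row3 x' z' 0) \in Kact A U.
  rewrite eG mem_gplane !mxE /= ex ez t0 mulr0 expr0n !eqxx !andbT; apply/eqP.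
  by apply: (sqr_inj_pchar2 charF2); rewrite /= sxz exprMn ex ez.
case/memKactP: uK => v vU ev; pose w := row3 x' z' 0 *m (invmx A)^T.
have vw : v = veronese w by rewrite -Kmap_veronese ev KmapK.
have w0 : w != 0.
  by rewrite -veronese_eq0 -vw -(Kmap_eq0 _ uA) -ev veronese_eq0.
move/pred0P/(_ <[v]>%VS)/negP: dis; apply; apply/andP; split.
  by rewrite /= vw mem_points_line ?veronese_eq0 // -vw.
by apply/mem_conic; exists w; rewrite w0 memvf vw.
Qed.

End Normalisation.

(* The line y = 0 of rep21 a consists of matrices with a common kernel vector;
   no such line exists in rep23 b. *)
Lemma rep23_notin_Korbit_rep21 (F : finFieldType) (charF2 : 2%N \in [pchar F]) (a b : F) :
  b != 0 -> rep23 b \notin Korbit (rep21 a).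
Proof.
move=> b0; apply/negP => /imsetP[A uA]; rewrite -gplane_rep21 -gplane_rep23 => eG.
pose v1 := gvec 1 a 0 0 1 0 0; pose v2 := gvec 1 a 0 0 0 0 1.
(* [v1] and [v2] span the line y = 0, whose matrices kill the last unit vector. Hence w is killed by
   the images of both. *)
have [w Aw] : exists w : 'cV[F]_3, A^T *m w = delta_mx 2 0.
  by exists (invmx A^T *m delta_mx 2 0); rewrite mulKVmx // unitmx_tr.
have w0 : w != 0.
  apply/eqP => w0; move: Aw; rewrite w0 mulmx0 => /matrixP/(_ 2 0)/eqP.
  by rewrite !mxE /= eq_sym oner_eq0.
have ker v : sym_mx v *m delta_mx 2 0 = 0 :> 'cV_3 -> sym_mx (Kmap A v) *m w = 0.
  by move=> e; rewrite sym_mx_Kmap -!mulmxA Aw e mulmx0.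
have k1 : sym_mx v1 *m delta_mx 2 0 = 0 :> 'cV_3.
  by apply/matrixP => -[[|[|[|//]]] i] j; rewrite -colE !mxE /= ?mxE /=; ring.
have k2 : sym_mx v2 *m delta_mx 2 0 = 0 :> 'cV_3.
  by apply/matrixP => -[[|[|[|//]]] i] j; rewrite -colE !mxE /= ?mxE /=; ring.
have [x1 [y1 [z1 e1]]] : exists x y z, Kmap A v1 = gvec 0 b 1 0 x y z.
  by apply/gplaneP; rewrite eG memKact ?gvec_in.
have [x2 [y2 [z2 e2]]] : exists x y z, Kmap A v2 = gvec 0 b 1 0 x y z.
  by apply/gplaneP; rewrite eG memKact ?gvec_in.
(* The line y = 0 misses the nucleus plane, so its image does too. Thus (x1, z1) and (x2, z2) are
   independent, which is the determinant condition [D0]. *)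
have nuc (s t : F) : s * x1 + t * x2 = 0 -> s * z1 + t * z2 = 0 -> s = 0 /\ t = 0.
  move=> hx hz; have : Kmap A (s *: v1 + t *: v2) \in nucleus_plane F.
    rewrite linearD !linearZ /= e1 e2 mem_nucleus_plane !mxE /= hx hz !mulr0 addr0.
    by rewrite eqxx.
  rewrite mem_nucleus_Kmap // mem_nucleus_plane !mxE /= !mulr0 !mulr1 addr0 add0r.
  by case/and3P => /eqP-> /eqP->.
have D0 : x1 * z2 + x2 * z1 != 0.
  apply/eqP => D0.
  have [z20 z10] : z2 = 0 /\ z1 = 0.
    by apply: nuc; [rewrite -[RHS]D0 | ring2 charF2]; ring.
  have [x20 x10] : x2 = 0 /\ x1 = 0.
    by apply: nuc; [ring2 charF2 | rewrite -[RHS]D0]; ring.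
  have [||/eqP] := nuc 1 0; rewrite ?x10 ?z10 ?mulr0 ?mul0r ?addr0 ?oner_eq0 //.
have eqs x y z : sym_mx (gvec 0 b 1 0 x y z) *m w = 0 ->
    x * (w 0 0 + w 2 0) + b * z * w 1 0 = 0 /\ x * w 0 0 + y * w 1 0 = 0.
  move/matrixP => h; have := h 0 0; have := h 2 0; rewrite !mxE !sum3E !mxE /= ?mxE /=.
  by move=> h2 h0; split; [rewrite -[RHS]h0 | rewrite -[RHS]h2]; ring.
have [f1 g1] := eqs _ _ _ (etrans (congr1 (fun v => sym_mx v *m w) (esym e1)) (ker _ k1)).
have [f2 g2] := eqs _ _ _ (etrans (congr1 (fun v => sym_mx v *m w) (esym e2)) (ker _ k2)).
(* Cramer elimination between the equations for the two images: the nonzero determinant forces the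
   coordinates of w to vanish one after another. *)
have w1 : w 1 0 = 0.
  apply/eqP; have : b * (x1 * z2 + x2 * z1) * w 1 0 == 0.
    have -> : b * (x1 * z2 + x2 * z1) * w 1 0 =
        x2 * (x1 * (w 0 0 + w 2 0) + b * z1 * w 1 0) +
        x1 * (x2 * (w 0 0 + w 2 0) + b * z2 * w 1 0) by ring2 charF2.
    by rewrite f1 f2 !mulr0 addr0.
  by rewrite !mulf_eq0 (negPf b0) (negPf D0).
have w00 : w 0 0 = 0.
  apply/eqP; have : (x1 * z2 + x2 * z1) * w 0 0 == 0.
    have -> : (x1 * z2 + x2 * z1) * w 0 0 =
        z2 * (x1 * w 0 0 + y1 * w 1 0) + z1 * (x2 * w 0 0 + y2 * w 1 0) by rewrite w1; ring.
    by rewrite g1 g2 !mulr0 addr0.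
  by rewrite mulf_eq0 (negPf D0).
have w20 : w 2 0 = 0.
  apply/eqP; have : (x1 * z2 + x2 * z1) * w 2 0 == 0.
    have -> : (x1 * z2 + x2 * z1) * w 2 0 =
        z2 * (x1 * (w 0 0 + w 2 0) + b * z1 * w 1 0) +
        z1 * (x2 * (w 0 0 + w 2 0) + b * z2 * w 1 0) by rewrite w1 w00; ring.
    by rewrite f1 f2 !mulr0 addr0.
  by rewrite mulf_eq0 (negPf D0).
move/eqP: w0; apply; apply: trmx_inj; rewrite trmx0.
by apply: eq_row3; rewrite !mxE.
Qed.

(** * Classification of the planes and distinctness of the three orbits *)

Theorem theorem4p5 (F : finFieldType) (charF2 : 2%N \in [pchar F])
    (q_ge4 : (4 <= #|F|)%N) :
  let q := #|F| in
  exists S21 S22 S23 : {set {vspace 'rV[F]_6}},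
    [/\ [/\ is_plane_orbit S21, is_plane_orbit S22 & is_plane_orbit S23],
        [/\ S21 <> S22, S21 <> S23 & S22 <> S23],
        forall pi P : {vspace 'rV[F]_6},
          \dim pi = 3%N ->
          [disjoint points pi & veronese_surface F] ->
          points pi :&: points (nucleus_plane F) = [set P] ->
          H_of_point P <> H_of_plane pi ->
          [\/ pi \in S21, pi \in S22 | pi \in S23],
        [/\ forall pi, pi \in S21 -> OD0 pi = [:: 0; 1; 2 * q; q ^ 2 - q]%N,
            forall pi, pi \in S22 -> OD0 pi = [:: 0; 1; q; q ^ 2]%N
          & forall pi, pi \in S23 -> OD0 pi = [:: 0; 1; 2 * q; q ^ 2 - q]%N]
      & forall a : F, trace2 a = 1 ->
          [/\ rep21 a \in S21, rep22 F \in S22 & rep23 a \in S23]].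
Proof.
(* The orbits are defined from one fixed a of trace 1; the last clause then shows that any other a'
   of trace 1 gives representatives of the same orbits. *)
move=> q; have [a ta] := ex_trace2_eq1 charF2; have a0 := trace2_neq0 charF2 ta.
have OD21 : forall pi, pi \in Korbit (rep21 a) -> OD0 pi = [:: 0; 1; 2 * q; q ^ 2 - q]%N.
  by move=> pi /(OD0_Korbit charF2) ->; apply: OD0_rep21.
have OD22 : forall pi, pi \in Korbit (rep22 F) -> OD0 pi = [:: 0; 1; q; q ^ 2]%N.
  by move=> pi /(OD0_Korbit charF2) ->; apply: OD0_rep22.
have OD23 : forall pi, pi \in Korbit (rep23 a) -> OD0 pi = [:: 0; 1; 2 * q; q ^ 2 - q]%N.
  by move=> pi /(OD0_Korbit charF2) ->; apply: OD0_rep23.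
have q0 : (0 < q)%N by apply: leq_trans q_ge4.
have n2q : (2 * q)%N <> q by move=> e; have := ltn_Pmull (isT : 1 < 2)%N q0; rewrite e ltnn.
exists (Korbit (rep21 a)), (Korbit (rep22 F)), (Korbit (rep23 a)); split.
- by split; [exists (rep21 a); rewrite // -gplane_rep21 dim_gplane
            |exists (rep22 F); rewrite // -gplane_rep22 dim_gplane
            |exists (rep23 a); rewrite // -gplane_rep23 dim_gplane].
(* The second orbit differs from the other two in its number of rank-2 points, q against 2q; the
   first and third are separated by the common-kernel argument. *)
- split=> e.
  + have := OD21 _ (Korbit_refl (rep21 a)); rewrite OD22 -?e ?Korbit_refl //.
    by case=> /esym.
  + have := rep23_notin_Korbit_rep21 charF2 a a0.
    by rewrite e Korbit_refl.
  + have := OD23 _ (Korbit_refl (rep23 a)); rewrite OD22 ?e ?Korbit_refl //.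
    by case=> /esym.
- move=> pi P dpi dis piN HH.
  have [c [c' [b [b' [nr piG]]]]] := normal_form charF2 dpi dis piN HH.
  by have [o|o|o] := gplane_Korbits charF2 ta nr; [constructor 1|constructor 2|constructor 3];
    apply: Korbit_trans o piG.
- by split.
move=> a' ta'; split; last 1 first.
- rewrite -gplane_rep23; apply: gplane_Korbit23; rewrite ?oner_eq0 //.
  exact: (trace2_neq0 charF2 ta').
- rewrite -gplane_rep21; apply: gplane_Korbit21; rewrite ?oner_eq0 ?mul1r //.
  exact: (trace2_neq0 charF2 ta').
exact: Korbit_refl.
Qed.
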